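(* For every real $x\ge 6$ we have $$-\frac{5}{3} < S_1(x) - \frac{x}{12} <\frac{1}{2} \log_2 x - \frac{19}{12}.$$ In particular, the natural density of the set $S_1$ in $\mathbb{N}$ exists and $$\lim_{x\to+\infty}\frac{S_1(x)}{x}=\frac{1}{12}.$$ Moreover, there exists an increasing sequence $(m_l)_{l\in\mathbb{N}}\subset\mathbb{N}$ such that $$S_1(m_l)-\frac{m_l}{12}\sim\frac12\log_2 m_l\qquad (l\to\infty).$$
   Context: $\mathbb{N}$ is the set of non-negative integers. The binary partition function $b_1(n)=b(n)$ is the number of partitions of $n$ into powers of two, i.e. $\sum_{n\ge 0} b_1(n)x^n=\prod_{j\ge 0}(1-x^{2^j})^{-1}$. Let $S_1=\{n\in\mathbb{N}: b_1(n)\neq x^2+y^2+z^2\text{ for any }x,y,z\in\mathbb{Z}\}$, and for real $x\ge 0$ let $S_1(x)=\#(S_1\cap[0,x])$ be its counting function. $a_l\sim c_l$ means $a_l/c_l\to 1$ as $l\to\infty$. *)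

(* Defs.v *)
From HB Require Import structures.
From mathcomp Require Import all_boot all_order all_algebra.
From mathcomp Require Import finmap.
From mathcomp Require Import all_classical all_reals all_analysis.

Set Implicit Arguments.
Unset Strict Implicit.
Unset Printing Implicit Defensive.

Import Order.TTheory GRing.Theory Num.Theory.
Import numFieldNormedType.Exports.

Local Open Scope classical_set_scope.
Local Open Scope ring_scope.

(* A partition of n is encoded by its multiplicities: m i is the number of
   parts equal to i.  Parts and multiplicities are all at most n, so both can
   range over 'I_n.+1; the value at i = 0 is forced to 0 as parts are positive. *)
Definition is_partition (n : nat) (m : {ffun 'I_n.+1 -> 'I_n.+1}) : bool :=
  (m ord0 == ord0) && (\sum_(i < n.+1) m i * i == n)%N.

Definition is_pow2 (k : nat) : bool := [exists j : 'I_k.+1, k == 2 ^ j]%N.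

Definition parts_pow2 (n : nat) (m : {ffun 'I_n.+1 -> 'I_n.+1}) : bool :=
  [forall i : 'I_n.+1, (0 < m i)%N ==> is_pow2 i].

Definition b1 (n : nat) : nat :=
  #|[set m : {ffun 'I_n.+1 -> 'I_n.+1} | is_partition m && parts_pow2 m]%SET|.

Definition S1 : set nat :=
  [set n | forall x y z : int, (b1 n)%:Z <> x ^+ 2 + y ^+ 2 + z ^+ 2].

(* #(A `&` [0, x]).  The set is finite for every x, so fset_set is not used at
   its default value on infinite sets. *)
Definition counting_fun (R : realType) (A : set nat) (x : R) : nat :=
  #|` fset_set (A `&` [set n | n%:R <= x]) |%fset.

Definition has_natural_density (R : realType) (A : set nat) (d : R) : Prop :=
  (counting_fun A (n%:R : R))%:R / n%:R @[n --> \oo] --> d.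

Definition log2 (R : realType) (x : R) : R := ln x / ln 2.

Definition asymp_equiv (R : realType) (a c : nat -> R) : Prop :=
  a l / c l @[l --> \oo] --> (1 : R).

(* Main.v *)
(* Removing the parts 1 gives b(n) = sum_{k <= n/2} b(k).  With a(n) = b(2n) and
   the iterated partial sums D, G of a, the pair (D, G) modulo 8 satisfies a closed
   2-adic recursion governed by the Thue-Morse sequence.  It follows that b(n) is
   1, or 2 modulo 4, or 4, 12, 20, 28 modulo 32, and that b(n) = 28 modulo 32
   exactly when n or n - 1 is 4^(k+1) (4p + 1) with p having an odd binary digit
   sum.  By the three-square theorem these n form S_1, and counting them base 4
   gives the bounds.

   The three-square theorem is proved for n = 1, 2 modulo 4 and n = 3 modulo 8, n
   squarefree: find a prime q = 1 modulo 4 with prescribed Legendre symbols modulo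
   the prime factors of n, such that, for t = q or 2q, Legendre's equation
   z^2 + t v^2 = n w^2 is solvable by the pigeonhole principle.  As t is a sum of two
   squares, n is a sum of three rational squares, hence of three integral ones
   (Davenport-Cassels).  Since only Legendre symbols are prescribed, q is found with
   real Dirichlet characters alone, through Mertens' estimate
   sum chi(d) Lambda(d) / d = O(1) and L(1, chi) <> 0. *)

Require Import Defs.
From HB Require Import structures.
From mathcomp Require Import all_boot all_order all_algebra.
From mathcomp Require Import finmap.
From mathcomp Require Import all_classical all_reals all_analysis.
From mathcomp Require Import zify ring lra.

Set Implicit Arguments.
Unset Strict Implicit.
Unset Printing Implicit Defensive.

Import Order.TTheory GRing.Theory Num.Theory.
Import numFieldNormedType.Exports.

Local Open Scope classical_set_scope.
Local Open Scope ring_scope.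

(** * The von Mangoldt function and Chebyshev's bound *)

(** Density and logarithm have one source. An [m] with [bp_28 m] is [4 * Q] with [bp_28 Q], or
    [4 * p + 1] with [p] odious. Half of all [p] are odious, so these [m] have density (1/8)(1 + 1/4
    + 1/16 + ...) = 1/6; each yields the two elements [4 * m] and [4 * m + 1] of [S1], whence 2/24 =
    1/12. The number of odious [p < Q] differs from [Q / 2] by 0 or 1/2 in either direction, and
    such an error enters once per base-4 digit. Positive errors accumulate along the base-4 digits
    2, 1 repeated, which produces the logarithm; negative ones do not, which gives a constant lower
    bound. The obstacle in the three-square theorem is that one prime must meet many quadratic
    conditions at once, and products of the characters involved may be principal. Independence is
    never proved: the twisted sums are bounded from below only, and a principal product can only
    help. *)

Section VonMangoldt.
Variable R : realType.

Lemma big_multiples (N d : nat) (F : nat -> R) : (0 < d)%N ->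
  \sum_(1 <= n < N.+1 | (d %| n)%N) F n = \sum_(1 <= e < (N %/ d).+1) F (d * e)%N.
Proof.
move=> d0; elim: N => [|N IH]; first by rewrite div0n !big_geq.
rewrite big_mkcond big_nat_recr //= -big_mkcond IH divnS //.
case: ifP => [dN|_]; last by rewrite addr0 add0n.
rewrite add1n [RHS]big_nat_recr //=; congr (_ + _); congr F.
by rewrite -[LHS](divnK dN) divnS // dN mulnC.
Qed.

Lemma big_nat_pred1 (N x : nat) (P : pred nat) (F : nat -> R) : (0 < x <= N)%N ->
  \sum_(1 <= d < N.+1 | P d && (x == d)) F d = if P x then F x else 0.
Proof.
move=> xN; rewrite big_mkcond (bigD1_seq x) ?iota_uniq ?mem_index_iota //= eqxx andbT.
by rewrite big1 ?addr0 // => d; rewrite eq_sym => /negbTE ->; rewrite andbF.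
Qed.

(** At most one pair [(p, k)] satisfies [p ^ k == d], so this is [ln p] at the positive powers of a
    prime [p] and 0 elsewhere. As a sum it can be exchanged with sums over [d]. *)
Definition mangoldt (d : nat) : R :=
  \sum_(1 <= p < d.+1 | prime p) \sum_(1 <= k < d.+1 | (p ^ k == d)%N) ln p%:R.

Lemma mangoldt_widen (N d : nat) : (d <= N)%N ->
  mangoldt d = \sum_(1 <= p < N.+1 | prime p) \sum_(1 <= k < N.+1 | (p ^ k == d)%N) ln p%:R.
Proof.
move=> dN; rewrite /mangoldt [RHS](@big_cat_nat _ _ _ d.+1) //= [X in _ = _ + X]big1_seq => [|p].
  rewrite addr0 big_nat_cond [RHS]big_nat_cond; apply: eq_bigr => p /andP[/andP[p1 pd] pp].
  rewrite [RHS](@big_cat_nat _ _ _ d.+1) //= [X in _ = _ + X]big1_seq ?addr0 // => k.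
  rewrite mem_index_iota => /andP[/eqP pk /andP[dk _]].
  by have := ltn_expl k (prime_gt1 pp); rewrite pk; move: dk; clear; lia.
rewrite mem_index_iota => /andP[pp /andP[dp _]]; apply: big1_seq => k.
rewrite mem_index_iota => /andP[/eqP pk /andP[k1 _]].
have : (p ^ 1 <= p ^ k)%N by apply: leq_pexp2l => //; apply: prime_gt0.
by rewrite pk expn1; move: dp; clear; lia.
Qed.

Lemma ln_nat_ge0 (n : nat) : 0 <= ln n%:R :> R.
Proof. by case: n => [|n]; [rewrite ln0|rewrite ln_ge0 // ler1n]. Qed.

Lemma mangoldt_ge0 d : 0 <= mangoldt d.
Proof. by rewrite sumr_ge0 // => p _; rewrite sumr_ge0 // => k _; apply: ln_nat_ge0. Qed.

Lemma sum_mangoldt_dvd (n : nat) : (0 < n)%N ->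
  \sum_(1 <= d < n.+1 | (d %| n)%N) mangoldt d = ln n%:R.
Proof.
move=> n0.
rewrite big_nat_cond (eq_bigr (fun d => \sum_(1 <= p < n.+1 | prime p)
   \sum_(1 <= k < n.+1 | (p ^ k == d)%N) ln p%:R)); last first.
  by move=> d /andP[/andP[_ dn] _]; apply: mangoldt_widen.
rewrite -big_nat_cond exchange_big /=.
transitivity (\sum_(1 <= p < n.+1 | prime p) ln p%:R *+ logn p n : R); last first.
  have H s : {in s, forall p, 0 < p}%N ->
      ln (\prod_(p <- s) p ^ logn p n)%N%:R = \sum_(p <- s) ln p%:R *+ logn p n :> R.
    elim: s => [|p s IH] hs; first by rewrite !big_nil ln1.
    have p0 : (0 < p)%N by apply: hs; rewrite inE eqxx.
    rewrite !big_cons natrM lnM ?IH; first by rewrite natrX lnXn ?ltr0n.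
    - by move=> q qs; apply: hs; rewrite inE qs orbT.
    - by rewrite posrE ltr0n expn_gt0 p0.
    rewrite posrE ltr0n big_seq; apply: prodn_cond_gt0 => q qs.
    by rewrite expn_gt0 hs // inE qs orbT.
  rewrite -[in RHS](partnT n0) /partn.
  rewrite (eq_bigl xpredT) // big_ltn // (_ : logn 0 n = 0)%N // expn0 mul1n.
  rewrite H => [|p]; last by rewrite mem_index_iota => /andP[].
  rewrite big_mkcond; apply: eq_bigr => p _; case: ifP => // np.
  by rewrite lognE np.
rewrite big_nat_cond [RHS]big_nat_cond; apply: eq_bigr => p /andP[/andP[p1 pn] pp].
rewrite (exchange_big_dep xpredT) //=.
transitivity (\sum_(1 <= k < n.+1 | (p ^ k %| n)%N) ln p%:R : R).
  rewrite [RHS]big_mkcond; apply: eq_bigr => k _.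
  case: (leqP (p ^ k) n) => pkn.
    by rewrite (big_nat_pred1 (fun d => d %| n)%N (fun=> ln p%:R)) // expn_gt0 prime_gt0.
  rewrite big1_seq => [|d]; last first.
    rewrite mem_index_iota => /andP[/andP[dn /eqP pk]]; rewrite -pk; move: pkn; clear; lia.
  by case: ifP => // /(dvdn_leq n0); rewrite leqNgt pkn.
(* The term [k = n] is split off and vanishes since [p ^ n > n]; [logn_count_dvd] sums over
   [k < n]. *)
rewrite big_mkcond /= big_nat_recr //= -big_mkcond.
have -> : (p ^ n %| n)%N = false.
  by apply/negbTE/negP => /(dvdn_leq n0); have := ltn_expl n (prime_gt1 pp); clear; lia.
rewrite addr0 logn_count_dvd // -sumrMnr big_mkcond; apply: eq_bigr => k _.
by case: (_ %| _)%N.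
Qed.

(** Write [ln n] as the sum of [mangoldt d] over its divisors and put [n = d * e]. The case [g = 1]
    expands factorials, the case [g n = chi n / n] gives Mertens' estimate. *)
Lemma sum_mul_ln (N : nat) (g : nat -> R) :
  \sum_(1 <= n < N.+1) g n * ln n%:R =
  \sum_(1 <= d < N.+1) mangoldt d * \sum_(1 <= e < (N %/ d).+1) g (d * e)%N.
Proof.
transitivity (\sum_(1 <= n < N.+1) \sum_(1 <= d < N.+1 | (d %| n)%N) mangoldt d * g n).
  apply: eq_big_nat => n /andP[n0 nN].
  rewrite -sum_mangoldt_dvd // -mulr_suml mulrC; congr (_ * _).
  rewrite [RHS](@big_cat_nat _ _ _ n.+1) //= [X in _ = _ + X]big1_seq ?addr0 // => d.
  by rewrite mem_index_iota => /andP[/dvdn_leq - /(_ n0)]; clear; lia.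
rewrite (exchange_big_dep xpredT) //=; apply: eq_big_nat => d /andP[d0 _].
by rewrite -mulr_sumr big_multiples.
Qed.

Lemma mangoldt_le_ln d : (0 < d)%N -> mangoldt d <= ln d%:R.
Proof.
move=> d0; rewrite -sum_mangoldt_dvd // big_mkcond big_nat_recr //= dvdnn lerDr.
by rewrite -big_mkcond sumr_ge0 // => i _; apply: mangoldt_ge0.
Qed.

Lemma sum_ln_fact N : \sum_(1 <= n < N.+1) ln n%:R = ln N`!%:R :> R.
Proof.
elim: N => [|N IH]; first by rewrite big_geq // ln1.
rewrite big_nat_recr //= IH factS natrM lnM ?posrE ?ltr0n ?fact_gt0 //.
by rewrite addrC.
Qed.

(** Terms with [d > N] vanish; the free end [M] lets two factorials be expanded over the same
    range. *)
Lemma ln_factE (M N : nat) : (N <= M)%N ->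
  ln N`!%:R = \sum_(1 <= d < M.+1) mangoldt d * (N %/ d)%:R :> R.
Proof.
move=> NM; rewrite -sum_ln_fact.
transitivity (\sum_(1 <= n < N.+1) 1 * ln n%:R : R); first by apply: eq_bigr => n _; rewrite mul1r.
rewrite (sum_mul_ln N (fun=> 1)) [RHS](@big_cat_nat _ _ _ N.+1) //=.
rewrite [X in _ = _ + X]big1_seq ?addr0 => [|d]; last first.
  by rewrite mem_index_iota => /andP[_ /andP[Nd _]]; rewrite divn_small // mulr0.
by apply: eq_bigr => d _; rewrite sumr_const_nat subn1.
Qed.

Lemma ln_le_subr1 (x : R) : 0 < x -> ln x <= x - 1.
Proof. by move=> x0; rewrite -[x in ln x](subrKC 1) le_ln1Dx // ltrBrDl subrr. Qed.

Lemma ln_add1_sub_le (x : R) : 0 < x -> ln (x + 1) - ln x <= x^-1.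
Proof.
move=> x0; rewrite -ln_div ?posrE ?addr_gt0 //.
apply: le_trans (ln_le_subr1 _) _; first by rewrite divr_gt0 ?addr_gt0.
by rewrite mulrDl divff ?gt_eqF // mul1r addrAC subrr add0r.
Qed.

(** In the logarithm of the central binomial coefficient, [mangoldt d] occurs with the factor
    [n.*2 %/ d - 2 * (n %/ d)], which is nonnegative, and at least 1 for [n < d <= n.*2]. The
    binomial coefficient is at most [2 ^ n.*2], and [ln 2 <= 1]. *)
Lemma chebyshev_double n :
  \sum_(1 <= d < n.*2.+1) mangoldt d <= \sum_(1 <= d < n.+1) mangoldt d + n.*2%:R.
Proof.
have bin_le : ln 'C(n.*2, n)%:R <= n.*2%:R :> R.
  have b0 : (0 < 'C(n.*2, n))%N by rewrite bin_gt0 -addnn leq_addr.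
  apply: (@le_trans _ _ (ln (2 ^ n.*2)%:R)).
    rewrite ler_ln ?posrE ?ltr0n ?expn_gt0 // ler_nat.
    have -> : (2 ^ n.*2 = \sum_(i < n.*2.+1) 'C(n.*2, i))%N.
      rewrite -[2%N]/(1 + 1)%N expnDn; apply: eq_bigr => i _.
      by rewrite !exp1n !muln1.
    have hn : (n < n.*2.+1)%N by rewrite -addnn ltnS leq_addr.
    by rewrite (bigD1 (Ordinal hn)) //= leq_addr.
  rewrite natrX lnXn // -[leRHS]mulr1 mulr_natl ler_wMn2r //.
  by apply: (le_trans (ln_le_subr1 _)) => //; lra.
have e : ln 'C(n.*2, n)%:R = ln n.*2`!%:R - 2 * ln n`!%:R :> R.
  have := @bin_fact n.*2 n; rewrite -addnn leq_addr addnK => /(_ isT) <-.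
  have b0 : (0 < 'C(n + n, n))%N by rewrite bin_gt0 leq_addr.
  by rewrite !natrM !lnM ?posrE ?mulr_gt0 ?ltr0n ?fact_gt0 //; ring.
have nn : (n <= n.*2)%N by rewrite -addnn leq_addr.
rewrite (ln_factE (leqnn n.*2)) (ln_factE nn) mulr_sumr -sumrB in e.
rewrite -lerBlDl; apply: le_trans bin_le; rewrite e.
rewrite [X in X - _](@big_cat_nat _ _ _ n.+1) //= addrAC subrr add0r.
rewrite [leRHS](@big_cat_nat _ _ _ n.+1) //= -[leLHS]add0r lerD //.
  apply: sumr_ge0 => d _; rewrite mulrCA -mulrBr mulr_ge0 ?mangoldt_ge0 //.
  rewrite subr_ge0 -natrM ler_nat.
  case: d => [|d]; first by rewrite !divn0.
  by rewrite leq_divRL //; have := leq_divM n d.+1; clear; nia.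
rewrite !big_seq; apply: ler_sum => d; rewrite mem_index_iota => /andP[d1 d2].
rewrite mulrCA -mulrBr ler_peMr ?mangoldt_ge0 // (divn_small (_ : n < d)%N) //.
rewrite mulr0 subr0 ler1n divn_gt0 //.
by move: d1; clear; lia.
Qed.

(** Passing from [N./2] to [N] costs [N./2.*2] by [chebyshev_double], plus [ln N <= N - 1] if [N] is
    odd; the constant 4 absorbs both. *)
Lemma chebyshev_psi N : \sum_(1 <= d < N.+1) mangoldt d <= 4 * N%:R.
Proof.
elim/ltn_ind: N => N IH.
have [N1|N1] := leqP N 0; first by have -> : N = 0%N by [lia]; rewrite big_geq // mulr0.
have := IH N./2 (ltac:(move: N1; clear; lia)).
have := chebyshev_double N./2.
set A := \sum_(_ <= _ < _) _; set B := \sum_(_ <= _ < _) _; set C := \sum_(_ <= _ < _) _.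
have e : C <= A + (odd N)%:R * (N./2.*2)%:R.
  have eN := odd_double_half N; rewrite /C -[in X in X <= _]eN.
  case: (odd N) => /=; last by rewrite mul0r addr0.
  rewrite add1n big_nat_recr //= lerD2l mul1r.
  apply: le_trans (mangoldt_le_ln _) _ => //.
  by apply: le_trans (ln_le_subr1 _) _ => //; rewrite -natr1 addrK.
have : N%:R = (odd N)%:R + 2 * (N./2)%:R :> R.
  by rewrite -[in LHS](odd_double_half N) natrD -muln2 natrM mulrC.
have : (N./2.*2)%:R = 2 * (N./2)%:R :> R by rewrite -muln2 natrM mulrC.
have h0 : 0 <= (N./2)%:R :> R by [].
by move: e; case: (odd N) => /=; move: (N./2)%:R h0; clear => *; lra.
Qed.

(** Compare the lower bound [N ln N - N] for the logarithm of the factorial with its expansion,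
    where [N %/ d] is at most [N / d]. *)
Lemma ln_le_sum_mangoldt N : (0 < N)%N ->
  ln N%:R - 1 <= \sum_(1 <= d < N.+1) mangoldt d / d%:R.
Proof.
move=> N0; have h : N%:R * ln N%:R - N%:R <= ln N`!%:R :> R.
  elim: N N0 => // -[_ _|N IH _]; first by rewrite ln1 mulr0 sub0r lerN10.
  rewrite factS natrM lnM ?posrE ?ltr0n ?fact_gt0 //.
  have {}IH := IH isT; set x : R := N.+1%:R in IH *.
  have x0 : 0 < x by rewrite ltr0n.
  have -> : N.+2%:R = x + 1 by rewrite natr1.
  have := ln_add1_sub_le x0.
  rewrite -(ler_pM2l x0) divff ?gt_eqF // => h.
  by move: h IH; move: (ln _) (ln _) (ln _) x0; clear => a b c x0 h IH; lra.
have Np : (0 : R) < N%:R by rewrite ltr0n.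
rewrite -(ler_pM2l Np) mulrBr mulr1; apply: le_trans h _.
rewrite (ln_factE (leqnn N)) mulr_sumr !big_seq; apply: ler_sum => d.
rewrite mem_index_iota => /andP[d0 _].
rewrite mulrCA ler_wpM2l ?mangoldt_ge0 // ler_pdivlMr ?ltr0n //.
by rewrite -natrM ler_nat leq_divM.
Qed.
End VonMangoldt.

(** * Bounded contribution of the higher prime powers *)

Section PrimePowers.
Variable R : realType.

(** The bound telescopes: the decrease of [(ln x + 2) / x] from [x] to [x + 1] dominates the new
    term because [(x + 1) (ln (x + 1) - ln x) <= 2]. *)
Lemma sum_ln_div (N : nat) : (0 < N)%N ->
  \sum_(2 <= n < N.+1) ln n%:R / (n%:R * (n%:R - 1)) <= 2 - (ln N%:R + 2) / N%:R :> R.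
Proof.
case: N => // N _; elim: N => [|N IH]; first by rewrite big_geq // ln1 add0r divr1 subrr.
rewrite big_nat_recr //=.
set x : R := N.+1%:R in IH *; have x0 : 0 < x by rewrite ltr0n.
have -> : N.+2%:R = x + 1 by rewrite natr1.
have y0 : 0 < x + 1 by rewrite addr_gt0.
have h := ln_add1_sub_le x0.
apply: le_trans (lerD IH (lexx _)) _; rewrite addrK -subr_ge0.
have x1 : 1 <= x by rewrite ler1n.
have -> : 2 - (ln (x + 1) + 2) / (x + 1) - (2 - (ln x + 2) / x + ln (x + 1) / ((x + 1) * x))
   = (2 - (x + 1) * (ln (x + 1) - ln x)) / (x * (x + 1)).
  by field; rewrite !gt_eqF.
apply: divr_ge0; last by rewrite mulr_ge0 ?ltW.
rewrite subr_ge0; apply: le_trans (ler_wpM2l (ltW y0) h) _.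
by rewrite ler_pdivrMr //; lra.
Qed.

Lemma geometric_tail (x : R) n : \sum_(2 <= k < n.+2) x ^+ k * (1 - x) = x ^+ 2 - x ^+ n.+2.
Proof.
elim: n => [|n IH]; first by rewrite big_geq // subrr.
by rewrite big_nat_recr //= IH (exprS x n.+2); ring.
Qed.

(** Only [p ^ k] with [k >= 2] counts, and the geometric series over [k] is at most
    [ln p / (p (p - 1))]. Hence divergence over prime powers forces divergence over primes. *)
Lemma sum_mangoldt_nonprime N :
  \sum_(1 <= d < N.+1 | ~~ prime d) mangoldt R d / d%:R <= 2.
Proof.
case: N => [|N]; first by rewrite big_geq.
have -> : \sum_(1 <= d < N.+2 | ~~ prime d) mangoldt R d / d%:R =
  \sum_(1 <= p < N.+2 | prime p) \sum_(1 <= k < N.+2)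
     \sum_(1 <= d < N.+2 | ~~ prime d && (p ^ k == d)%N) ln p%:R / d%:R.
  transitivity (\sum_(1 <= d < N.+2 | ~~ prime d) \sum_(1 <= p < N.+2 | prime p)
     \sum_(1 <= k < N.+2 | (p ^ k == d)%N) ln p%:R / d%:R : R).
    rewrite big_nat_cond [RHS]big_nat_cond; apply: eq_bigr => d /andP[/andP[_ dN] _].
    rewrite (@mangoldt_widen R N.+1) // mulr_suml; apply: eq_bigr => p _.
    by rewrite mulr_suml.
  rewrite (exchange_big_dep prime) //=; apply: eq_bigr => p pp.
  rewrite (exchange_big_dep xpredT) //=; apply: eq_bigr => k _.
  by apply: eq_bigl => d; rewrite pp andbT.
apply: (@le_trans _ _ (\sum_(1 <= p < N.+2 | prime p) ln p%:R / (p%:R * (p%:R - 1)))); last first.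
  rewrite big_mkcond big_ltn //= add0r.
  apply: le_trans (_ : _ <= \sum_(2 <= n < N.+2) ln n%:R / (n%:R * (n%:R - 1))) _.
    rewrite !big_seq; apply: ler_sum => p; rewrite mem_index_iota => /andP[p2 _].
    case: ifP => // _; rewrite divr_ge0 ?ln_nat_ge0 // mulr_ge0 // subr_ge0 ler1n.
    exact: ltnW.
  apply: le_trans (sum_ln_div _) _ => //.
  by rewrite gerBl divr_ge0 // addr_ge0 // ln_nat_ge0.
apply: ler_sum => p pp.
have p2 : (2 : R) <= p%:R by rewrite ler_nat prime_gt1.
have p0 : (0 : R) < p%:R by rewrite ltr0n prime_gt0.
have pm : (0 : R) < p%:R - 1 by lra.
apply: (@le_trans _ _ (\sum_(2 <= k < N.+2) ln p%:R * p%:R^-1 ^+ k)).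
  rewrite big_ltn // [X in X + _]big1_seq ?add0r; last first.
    by move=> d /andP[/andP[np /eqP pd] _]; rewrite -pd expn1 pp in np.
  apply: ler_sum => k _; case: (leqP (p ^ k) N.+1) => pk.
    rewrite (@big_nat_pred1 R _ _ (fun d => ~~ prime d)) ?expn_gt0 ?prime_gt0 //.
    by case: ifP => _; rewrite ?natrX ?exprVn // mulr_ge0 ?ln_nat_ge0 // exprn_ge0 // invr_ge0 ltW.
  rewrite big1_seq ?mulr_ge0 ?ln_nat_ge0 ?exprn_ge0 ?invr_ge0 ?ltW // => d.
  by rewrite mem_index_iota => /andP[/andP[_ /eqP <-]] /andP[_]; rewrite ltnNge pk.
rewrite -mulr_sumr ler_wpM2l ?ln_nat_ge0 //.
have x1 : 0 < 1 - p%:R^-1 :> R by rewrite subr_gt0 invf_lt1 //; lra.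
rewrite -(ler_pM2r x1) mulr_suml geometric_tail.
apply: (@le_trans _ _ (p%:R^-1 ^+ 2)); first by rewrite gerBl exprn_ge0 // invr_ge0 ltW.
suff -> : p%:R^-1 ^+ 2 = (p%:R * (p%:R - 1))^-1 * (1 - p%:R^-1) :> R by [].
by field; rewrite !gt_eqF.
Qed.
End PrimePowers.

(** * Real Dirichlet characters *)

Section AbelSummation.
Variable R : realType.

(** Summation by parts. The factor 2 appears because a block of [c] starting at [a] is a difference
    of two initial sums. *)
Lemma abel_bound (c f : nat -> R) (B : R) (a b : nat) :
  (forall n, `|\sum_(0 <= k < n) c k| <= B) ->
  (forall k, (a <= k)%N -> 0 <= f k.+1 <= f k) -> 0 <= f a -> (a <= b)%N ->
  `|\sum_(a <= k < b) c k * f k| <= 2 * B * f a.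
Proof.
move=> hB hf fa0 ab.
have cB n : (a <= n)%N -> `|\sum_(a <= k < n) c k| <= 2 * B.
  move=> an; have := hB n; have := hB a; rewrite [in X in _ -> X](@big_cat_nat _ _ _ a) //=.
  set A := \sum_(_ <= _ < _) _; set C := \sum_(_ <= _ < _) _ => h1 h2.
  have -> : C = (A + C) - A by ring.
  by apply: le_trans (ler_normB _ _) _; lra.
have f0 k : (a <= k)%N -> 0 <= f k.
  by case: (ltngtP a k) => [||<- //] // h _; case: k h => // k h; case/andP: (hf k h).
(* With the boundary term subtracted, the bound telescopes in [f a - f b] and can be proved by
   induction on the length. *)
suff h : `|\sum_(a <= k < b) c k * f k - (\sum_(a <= k < b) c k) * f b| <= 2 * B * (f a - f b).
  have h2 : `|(\sum_(a <= k < b) c k) * f b| <= 2 * B * f b.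
    by rewrite normrM (ger0_norm (f0 _ ab)) ler_wpM2r ?f0 ?cB.
  rewrite -(subrK ((\sum_(a <= k < b) c k) * f b) (\sum_(a <= k < b) c k * f k)).
  by apply: le_trans (ler_normD _ _) _; apply: le_trans (lerD h h2) _; rewrite -mulrDr subrK.
move: ab => /subnKC <-; elim: (b - a)%N => [|n IH].
  by rewrite addn0 !big_geq // mul0r !subrr normr0 mulr0.
rewrite addnS !big_nat_recr ?leq_addr //=.
set S := \sum_(_ <= _ < _) _ in IH *; set T := \sum_(_ <= _ < _) _ in IH *.
set m := (a + n)%N in IH *; have am : (a <= m)%N by rewrite leq_addr.
have -> : S + c m * f m - (T + c m) * f m.+1 = (S - T * f m) + (T + c m) * (f m - f m.+1) by ring.
apply: le_trans (ler_normD _ _) _; have [_ fm] := andP (hf m am).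
have h : `|(T + c m) * (f m - f m.+1)| <= 2 * B * (f m - f m.+1).
  have fm' : 0 <= f m - f m.+1 by rewrite subr_ge0.
  rewrite normrM (ger0_norm fm') ler_wpM2r //.
  by have := cB m.+1 (leqW am); rewrite big_nat_recr.
by apply: le_trans (lerD IH h) _; rewrite -mulrDr addrA subrK.
Qed.
End AbelSummation.

Section RealCharacterSums.
Variables (R : realType) (m : nat) (chi : nat -> R).
Hypothesis m0 : (0 < m)%N.
Hypothesis chiM : forall a b, chi (a * b)%N = chi a * chi b.
Hypothesis chi_per : forall a, chi (a + m)%N = chi a.
Hypothesis chi_unit : forall a, coprime a m -> chi a = 1 \/ chi a = -1.
Hypothesis chi_zero : forall a, ~~ coprime a m -> chi a = 0.

Lemma chi_values a : [\/ chi a = 0, chi a = 1 | chi a = -1].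
Proof.
have [/chi_unit[]|/chi_zero] := boolP (coprime a m) => h.
- by apply: Or32.
- by apply: Or33.
by apply: Or31.
Qed.

Lemma chi_norm_le1 a : `|chi a| <= 1.
Proof. by case: (chi_values a) => ->; rewrite ?normr0 ?normrN ?normr1. Qed.

Lemma chi_1 : chi 1 = 1.
Proof.
have := chiM 1 1; rewrite mul1n; case: (chi_unit (coprime1n m)) => -> //.
by rewrite mulrNN mulr1 => /esym.
Qed.

Lemma chi_modn a : chi (a %% m) = chi a.
Proof.
rewrite [in RHS](divn_eq a m) addnC; elim: (a %/ m)%N => [|q IH]; first by rewrite mul0n addn0.
by rewrite mulSnr addnA chi_per.
Qed.

(** Multiplication by [u] permutes the residues modulo [m] and changes the sign of the sum. *)
Lemma chi_sum_period (u : nat) : coprime u m -> chi u = -1 -> \sum_(i < m) chi i = 0.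
Proof.
move=> um hu; pose h (i : 'I_m) : 'I_m := Ordinal (ltn_pmod (u * i) m0).
have hI : injective h.
  move=> i j /(congr1 val) /= /eqP; wlog ij : i j / (i <= j)%N.
    move=> H; case: (leqP i j) => [|/ltnW] ij; first exact: H.
    by rewrite eq_sym => /(H _ _ ij)/esym.
  rewrite eq_sym eqn_mod_dvd ?leq_mul2l ?ij ?orbT // -mulnBr Gauss_dvdr; last by rewrite coprime_sym.
  move=> d; apply/val_inj => /=; have := ltn_ord j.
  case: (posnP (j - i)%N) => [|ji]; first by move: ij; clear; lia.
  by move/(dvdn_leq ji): d; clear; lia.
have e : \sum_(i < m) chi i = - \sum_(i < m) chi i.
  rewrite [LHS](reindex_inj hI) /= -mulN1r -hu mulr_sumr; apply: eq_bigr => i _.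
  by rewrite chi_modn chiM.
have : 2 * \sum_(i < m) chi i = 0 by rewrite mulr_natl mulr2n {1}e addNr.
by move/eqP; rewrite mulf_eq0 pnatr_eq0 /= => /eqP.
Qed.

Variable u : nat.
Hypothesis um : coprime u m.
Hypothesis chi_u : chi u = -1.

Lemma chi_partial_sum N : `|\sum_(0 <= k < N) chi k| <= m%:R.
Proof.
elim/ltn_ind: N => N IH; have [Nm|mN] := leqP N m.
  apply: le_trans (ler_norm_sum _ _ _) _.
  apply: le_trans (ler_sum _ (fun i _ => chi_norm_le1 i)) _.
  by rewrite sumr_const_nat subn0 ler_nat.
rewrite -(subnKC (ltnW mN)) (@big_cat_nat _ _ _ m) ?leq_addr //=.
rewrite big_mkord (chi_sum_period um chi_u) add0r -{1}[m]add0n big_addn addKn.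
under eq_bigr do rewrite chi_per.
by apply: IH; move: m0 mN; clear; lia.
Qed.

Lemma chi_abel (f : nat -> R) (a b : nat) :
  (forall k, (a <= k)%N -> 0 <= f k.+1 <= f k) -> 0 <= f a -> (a <= b)%N ->
  `|\sum_(a <= k < b) chi k * f k| <= 2 * m%:R * f a.
Proof. by move=> hf fa ab; apply: abel_bound => //; apply: chi_partial_sum. Qed.

Definition dirichlet_partial (N : nat) : R := \sum_(1 <= k < N.+1) chi k / k%:R.

(** The intervals of radius [e N] about the partial sums meet pairwise, so the supremum of their
    lower ends lies in all of them. *)
Lemma dirichlet_L_exists : exists L : R, forall N,
  `|dirichlet_partial N - L| <= 2 * m%:R / N.+1%:R.
Proof.
pose e N : R := 2 * m%:R / N.+1%:R.
have e0 N : 0 <= e N by rewrite divr_ge0 // mulr_ge0.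
have tail N M : (N <= M)%N -> `|dirichlet_partial M - dirichlet_partial N| <= e N.
  move=> NM; rewrite /dirichlet_partial [X in X - _](@big_cat_nat _ _ _ N.+1) //=.
  rewrite addrAC subrr add0r; apply: (@chi_abel (fun k => k%:R^-1)) => //.
  move=> k Nk; have k0 : (0 < k)%N by apply: leq_trans Nk.
  by rewrite invr_ge0 ler0n /= lef_pV2 ?posrE ?ltr0n // ler_nat.
have cross N M : dirichlet_partial N - e N <= dirichlet_partial M + e M.
  have [NM|/ltnW MN] := leqP N M.
    by have := tail _ _ NM; have := e0 M; rewrite ler_norml => h /andP[]; lra.
  by have := tail _ _ MN; have := e0 N; rewrite ler_norml => h /andP[]; lra.
pose E := [set x | exists N, x = dirichlet_partial N - e N].
exists (sup E) => N; rewrite -/(e N).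
have lb : dirichlet_partial N - e N <= sup E.
  apply: ub_le_sup; last by exists N.
  by exists (dirichlet_partial 0 + e 0%N) => _ [M ->].
have ub : sup E <= dirichlet_partial N + e N.
  by apply: ge_sup => [|_ [M ->]]; first by exists (dirichlet_partial N - e N), N.
by rewrite ler_norml; move: lb ub; move: (e N) (sup E) => x y; lra.
Qed.

(** The sum of [chi n * ln n / n] is bounded by Abel summation. By [sum_mul_ln] it is also a sum
    over [d] of [chi d * mangoldt d / d] times a partial sum of the L-series up to [N %/ d].
    Replacing that partial sum by [L] costs at most [2 m * mangoldt d / N] per term, in total [8 m]
    by Chebyshev; then divide by [L]. *)
Lemma mertens_chi (L : R) : L != 0 ->
  (forall N, `|dirichlet_partial N - L| <= 2 * m%:R / N.+1%:R) ->
  exists C : R, forall N, `|\sum_(1 <= d < N.+1) chi d * mangoldt R d / d%:R| <= C.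
Proof.
move=> L0 hL.
have lnb : exists C : R, forall N, `|\sum_(1 <= n < N.+1) chi n / n%:R * ln n%:R| <= C.
  pose f n : R := ln n%:R / n%:R.
  have f0 n : 0 <= f n by rewrite divr_ge0 // ln_nat_ge0.
  have fdec k : (4 <= k)%N -> 0 <= f k.+1 <= f k.
    move=> k4; rewrite f0 /= /f.
    have k0 : (0 : R) < k%:R by rewrite ltr0n; apply: leq_trans k4.
    rewrite -natr1; set x : R := k%:R in k0 *.
    have x1 : 0 < x + 1 by rewrite addr_gt0.
    rewrite ler_pdivrMr // mulrAC ler_pdivlMr //.
    have h := ln_add1_sub_le k0.
    rewrite -(ler_pM2l k0) divff ?gt_eqF // in h.
    (* [ln x / x] decreases once [ln x >= 1]; from 4 on this follows from [ln 2^-1 <= - 2^-1]. *)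
    have ln4 : 1 <= ln x.
      apply: (@le_trans _ _ (ln 4)); last by rewrite ler_ln ?posrE // ler_nat.
      have -> : 4 = (2^-1 ^+ 2)^-1 :> R by rewrite exprVn invrK -natrX.
      rewrite lnV ?posrE ?exprn_gt0 ?invr_gt0 // lnXn ?invr_gt0 //.
      have : ln 2^-1 <= 2^-1 - 1 :> R by apply: ln_le_subr1; rewrite invr_gt0.
      by move: (ln 2^-1) => a; rewrite -mulr_natl; lra.
    by move: h ln4; move: (ln (x + 1)) (ln x) => a b h ln4; lra.
  exists (f 1%N + f 2%N + f 3%N + 2 * m%:R * f 4%N) => N.
  have -> : \sum_(1 <= n < N.+1) chi n / n%:R * ln n%:R = \sum_(1 <= n < N.+1) chi n * f n.
    by apply: eq_bigr => n _; rewrite /f mulrAC -!mulrA.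
  have cf n : `|chi n * f n| <= f n by rewrite normrM (ger0_norm (f0 n)) ler_piMl ?chi_norm_le1.
  have f123 : \sum_(1 <= n < 4) f n = f 1%N + f 2%N + f 3%N.
    by rewrite big_ltn // big_ltn // big_ltn // big_geq // addr0 addrA.
  have m2 : 0 <= 2 * m%:R * f 4%N by apply: mulr_ge0; rewrite ?f0 ?mulr_ge0.
  have fs : 0 <= f 1%N + f 2%N + f 3%N by rewrite !addr_ge0 ?f0.
  have [N4|N4] := leqP N 3.
    apply: (@le_trans _ _ (\sum_(1 <= n < 4) f n)); last first.
      by rewrite f123 lerDl.
    apply: le_trans (ler_norm_sum _ _ _) _.
    apply: le_trans (ler_sum _ (fun i _ => cf i)) _.
    by rewrite [leRHS](@big_cat_nat _ _ _ N.+1) //= lerDl sumr_ge0.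
  rewrite (@big_cat_nat _ _ _ 4) //=; last exact: ltnW.
  apply: le_trans (ler_normD _ _) _; apply: lerD.
    apply: le_trans (ler_norm_sum _ _ _) _.
    apply: le_trans (ler_sum _ (fun i _ => cf i)) _.
    by rewrite f123.
  by apply: chi_abel => //; apply: ltnW.
case: lnb => C hC; exists ((C + 8 * m%:R) / `|L|) => N.
rewrite ler_pdivlMr ?normr_gt0 // -normrM.
have := hC N; rewrite (sum_mul_ln N (fun n => chi n / n%:R)).
have -> : \sum_(1 <= d < N.+1) mangoldt R d * \sum_(1 <= e < (N %/ d).+1) chi (d * e)%N / (d * e)%N%:R
  = \sum_(1 <= d < N.+1) chi d * mangoldt R d / d%:R * dirichlet_partial (N %/ d)%N.
  apply: eq_bigr => d _; rewrite /dirichlet_partial [LHS]mulr_sumr [RHS]mulr_sumr; apply: eq_bigr => e _.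
  rewrite chiM natrM invfM; move: (chi d) (chi e) (mangoldt R d) (d%:R^-1) (e%:R^-1) => *; ring.
move=> h; have e : (\sum_(1 <= d < N.+1) chi d * mangoldt R d / d%:R) * L =
  \sum_(1 <= d < N.+1) chi d * mangoldt R d / d%:R * dirichlet_partial (N %/ d)%N -
  \sum_(1 <= d < N.+1) chi d * mangoldt R d / d%:R * (dirichlet_partial (N %/ d)%N - L).
  rewrite mulr_suml -sumrB; apply: eq_bigr => d _; ring.
rewrite e; apply: le_trans (ler_normB _ _) _; apply: lerD => //.
apply: le_trans (ler_norm_sum _ _ _) _.
have [N0|N0] := posnP N; first by rewrite N0 big_geq // mulr_ge0.
have NR : (0 : R) < N%:R by rewrite ltr0n.
apply: (@le_trans _ _ (\sum_(1 <= d < N.+1) mangoldt R d * (2 * m%:R / N%:R))); last first.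
  rewrite -mulr_suml; apply: le_trans (ler_wpM2r _ (chebyshev_psi R N)) _.
    by rewrite divr_ge0 // mulr_ge0.
  by rewrite (_ : 4 * N%:R * (2 * m%:R / N%:R) = 8 * m%:R) //; field; rewrite gt_eqF.
rewrite !big_seq; apply: ler_sum => d; rewrite mem_index_iota => /andP[d0 _].
have dR : (0 : R) < d%:R by rewrite ltr0n.
rewrite !normrM (ger0_norm (mangoldt_ge0 R d)) normfV (ger0_norm (ltW dR)) -!mulrA.
apply: le_trans (ler_piMl _ (chi_norm_le1 d)) _.
  by rewrite !mulr_ge0 // ?mangoldt_ge0 // invr_ge0 ltW.
rewrite ler_wpM2l ?mangoldt_ge0 // ler_pdivrMl //.
apply: le_trans (hL _) _.
have : N%:R <= d%:R * (N %/ d).+1%:R :> R.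
  by rewrite -natrM ler_nat mulnC ltnW // -ltn_divLR.
set q : R := (N %/ d).+1%:R => hq.
have q0 : 0 < q by rewrite ltr0n.
rewrite (_ : d%:R * (2 * (m%:R / N%:R)) = 2 * m%:R * d%:R / N%:R); last by ring.
by rewrite ler_pdivrMr // mulrAC ler_pdivlMr // -!mulrA ler_pM2l // ler_wpM2l.
Qed.
End RealCharacterSums.

(** * Non-vanishing of L(1, chi) *)

Section LambertWeights.
Variables (R : realType) (t : R).
Hypothesis t01 : 0 < t < 1.
Let S n := \sum_(0 <= i < n) t ^+ i.
Let t0 : 0 < t. Proof. by case/andP: t01. Qed.
Let t1 : 0 < 1 - t. Proof. by rewrite subr_gt0; case/andP: t01. Qed.

Lemma lambert_geomS n : S n.+1 = 1 + t * S n.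
Proof.
rewrite /S big_ltn // expr0 big_add1 /= mulr_sumr; congr (_ + _).
by apply: eq_bigr => i _; rewrite exprS.
Qed.

Lemma lambert_geom_mul n : (1 - t) * S n = 1 - t ^+ n.
Proof.
elim: n => [|n IH]; first by rewrite /S big_geq // mulr0 expr0 subrr.
by rewrite /S big_nat_recr //= mulrDr -/(S n) IH exprS; ring.
Qed.

Lemma lambert_geom_gt0 n : (0 < n)%N -> 0 < S n.
Proof.
case: n => // n _; rewrite lambert_geomS ltr_pwDl // mulr_ge0 //; first exact: ltW.
by apply: sumr_ge0 => i _; rewrite exprn_ge0 // ltW.
Qed.

(** The inequality of the arithmetic and geometric means for [1, t, ..., t ^ n.-1], multiplied by
    [Num.sqrt t] to keep exponents integral. The induction goes by two, pairing the outer terms: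
    [2 y <= 1 + y ^ 2]. *)
Lemma lambert_geom_lower n : n%:R * Num.sqrt t ^+ n <= Num.sqrt t * S n.
Proof.
set r := Num.sqrt t; have r2 : t = r ^+ 2 by rewrite sqr_sqrtr // ltW.
have r0 : 0 < r by rewrite sqrtr_gt0.
have SS k : S k.+2 = 1 + t * S k + t ^+ k.+1.
  by rewrite {1}/S big_nat_recr //= -/(S k.+1) lambert_geomS.
suff h : n%:R * r ^+ n <= r * S n /\ n.+1%:R * r ^+ n.+1 <= r * S n.+1 by case: h.
elim: n => [|n [IH1 IH2]].
  by rewrite mul0r /S big_geq // mulr0 big_nat1 expr0 mul1r mulr1 expr1.
split => //; rewrite SS.
have -> : r * (1 + t * S n + t ^+ n.+1) = r ^+ 2 * (r * S n) + r * (1 + (r ^+ n.+1) ^+ 2).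
  by rewrite -exprM mulnC exprM -r2; ring.
have -> : n.+2%:R * r ^+ n.+2 = r ^+ 2 * (n%:R * r ^+ n) + r * (2 * r ^+ n.+1).
  have -> : n.+2%:R = n%:R + 2 :> R by rewrite -natrD addn2.
  by rewrite (exprS r n.+1) (exprS r n); ring.
apply: lerD; rewrite ler_pM2l ?exprn_gt0 //.
by have := sqr_ge0 (1 - r ^+ n.+1); rewrite sqrrB expr1n mul1r -mulr_natl; move: (r ^+ n.+1) => y; lra.
Qed.

Lemma sqrt_lambert_bounds : [/\ 0 < Num.sqrt t, t <= Num.sqrt t & Num.sqrt t <= 1].
Proof.
have r0 : 0 < Num.sqrt t by rewrite sqrtr_gt0.
have r1 : Num.sqrt t <= 1 by rewrite -sqrtr1 ler_wsqrtr //; case/andP: t01 => _ /ltW.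
by split => //; rewrite -{1}(sqr_sqrtr (ltW t0)) expr2 ler_piMl // ltW.
Qed.

(* The Lambert term [t^n / (1 - t^n)] is [1 / (n (1 - t))] minus this weight;
   the weights decrease with [n], so Abel summation applies to them. *)
Definition lambert_weight (n : nat) : R := (n%:R^-1 - t ^+ n / S n) / (1 - t).

(** Over a common denominator the decrease has numerator [S n * S n.+1 - n (n + 1) t ^ n], up to a
    positive factor; it is nonnegative by [lambert_geom_lower] at [n] and [n.+1]. *)
Lemma lambert_weight_dec n : (0 < n)%N -> 0 <= lambert_weight n.+1 <= lambert_weight n.
Proof.
move=> n0; have [r0 tr r1] := sqrt_lambert_bounds.
have Sn := lambert_geom_gt0 n0; have Sn1 := lambert_geom_gt0 (ltn0Sn n).
have nR : (0 : R) < n%:R by rewrite ltr0n.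
have r2 : Num.sqrt t ^+ 2 = t by rewrite sqr_sqrtr // ltW.
apply/andP; split.
  apply: divr_ge0; last exact: ltW.
  rewrite subr_ge0 ler_pdivrMr // -ler_pdivrMl ?invr_gt0 ?ltr0n // invrK.
  rewrite -(ler_pM2l r0); apply: le_trans (lambert_geom_lower n.+1).
  have et : t ^+ n.+1 = Num.sqrt t ^+ (2 * n.+1) by rewrite exprM r2.
  rewrite mulrCA ler_pM2l ?ltr0n // et -exprS.
  apply: ler_wiXn2l => //.
  by rewrite leqW // mul2n -addnn leq_addr.
rewrite /lambert_weight ler_pM2r ?invr_gt0 // -subr_ge0.
have key : n%:R * (n%:R + 1) * t ^+ n <= S n * S n.+1.
  rewrite -(ler_pM2l t0); apply: (@le_trans _ _ (Num.sqrt t * (n%:R * (n%:R + 1) * t ^+ n))).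
    by rewrite ler_wpM2r // !mulr_ge0 ?addr_ge0 ?exprn_ge0 // ltW.
  have -> : Num.sqrt t * (n%:R * (n%:R + 1) * t ^+ n) =
     (n%:R * Num.sqrt t ^+ n) * (n.+1%:R * Num.sqrt t ^+ n.+1).
    by rewrite -natr1 exprS -{2}r2 -exprM mulnC exprM; ring.
  have -> : t * (S n * S n.+1) = (Num.sqrt t * S n) * (Num.sqrt t * S n.+1).
    by rewrite -{1}r2; ring.
  by apply: ler_pM; first [exact: lambert_geom_lower | rewrite mulr_ge0 ?exprn_ge0].
have e1 : S n.+1 = S n + t ^+ n by rewrite /S big_nat_recr.
have e2 : t ^+ n = 1 - (1 - t) * S n by rewrite lambert_geom_mul; ring.
have -> : n%:R^-1 - t ^+ n / S n - (n.+1%:R^-1 - t ^+ n.+1 / S n.+1) =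
   (S n * S n.+1 - n%:R * (n%:R + 1) * t ^+ n) / (n%:R * (n%:R + 1) * (S n * S n.+1)).
  rewrite exprS -natr1 e1 in Sn1 *; rewrite e2 in Sn1 *.
  by field; rewrite !gt_eqF //= addr_gt0.
by rewrite divr_ge0 ?subr_ge0 // !mulr_ge0 ?addr_ge0 // ltW.
Qed.

Lemma lambert_weight1 : lambert_weight 1 = 1.
Proof.
by rewrite /lambert_weight /S big_nat1 expr0 expr1 invr1 mulr1 divff // gt_eqF.
Qed.

(** The last term is the tail of the geometric series beyond [q]. *)
Lemma lambert_term n q : (0 < n)%N ->
  \sum_(1 <= e < q.+1) t ^+ (n * e) =
  n%:R^-1 / (1 - t) - lambert_weight n - t ^+ (n * q.+1) / ((1 - t) * S n).
Proof.
move=> n0; have Sn := lambert_geom_gt0 n0.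
have nR : (0 : R) < n%:R by rewrite ltr0n.
have -> : n%:R^-1 / (1 - t) - lambert_weight n - t ^+ (n * q.+1) / ((1 - t) * S n) =
  (t ^+ n - t ^+ (n * q.+1)) / ((1 - t) * S n).
  by rewrite /lambert_weight; field; rewrite !gt_eqF.
have D0 : (1 - t) * S n != 0 by rewrite gt_eqF // mulr_gt0.
apply: (mulIf D0); rewrite mulfVK // lambert_geom_mul; elim: q => [|q IH].
  by rewrite big_geq // mul0r muln1 subrr.
by rewrite big_nat_recr //= mulrDl IH [in RHS]mulnS exprD; ring.
Qed.
End LambertWeights.

Lemma bernoulli_ineq (R : realType) (h : R) n : -1 <= h -> 1 + n%:R * h <= (1 + h) ^+ n.
Proof.
move=> h1; elim: n => [|n IH]; first by rewrite mul0r addr0 expr0.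
have hp : 0 <= 1 + h by lra.
rewrite exprS; apply: le_trans (ler_wpM2l hp IH).
rewrite -natr1; have : 0 <= n%:R * (h * h) by rewrite mulr_ge0 // -expr2 sqr_ge0.
by move: (n%:R : R) => y; lra.
Qed.

Section NonVanishing.
Variables (R : realType) (m : nat) (chi : nat -> R).
Hypothesis m0 : (0 < m)%N.
Hypothesis chiM : forall a b, chi (a * b)%N = chi a * chi b.
Hypothesis chi_per : forall a, chi (a + m)%N = chi a.
Hypothesis chi_unit : forall a, coprime a m -> chi a = 1 \/ chi a = -1.
Hypothesis chi_zero : forall a, ~~ coprime a m -> chi a = 0.

(** The convolution of [chi] with the constant 1: these are the coefficients of the product of the
    zeta function and the L-series. *)
Definition chi_divisor_sum (n : nat) : R := \sum_(1 <= d < n.+1 | (d %| n)%N) chi d.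
Local Notation g := chi_divisor_sum.

(** The divisors not divisible by [p ^ k.+1] are exactly those of [p ^ k * q]; the others are
    [p ^ k.+1 * e] with [e] dividing [q]. *)
Lemma chi_divisor_sum_step (p k q : nat) : prime p -> coprime p q -> (0 < q)%N ->
  g (p ^ k.+1 * q) = g (p ^ k * q) + chi p ^+ k.+1 * g q.
Proof.
move=> pp pq q0; have p0 := prime_gt0 pp.
have pk0 : (0 < p ^ k.+1)%N by rewrite expn_gt0 p0.
have chiX j : chi (p ^ j)%N = chi p ^+ j.
  elim: j => [|j IH]; first by rewrite expn0 expr0 (chi_1 chiM chi_unit).
  by rewrite expnS chiM IH exprS.
have key d : (d %| p ^ k.+1 * q)%N && ~~ (p ^ k.+1 %| d)%N = (d %| p ^ k * q)%N.
  apply/andP/idP => [[dN npd]|dk].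
    have d0 : (0 < d)%N.
      by case: d dN npd => // _; rewrite dvdn0.
    have [e pe ed] := pfactor_coprime pp d0.
    have jk : (logn p d <= k)%N.
      rewrite leqNgt; apply: contra npd => kj; rewrite ed dvdn_mull //.
      exact: dvdn_exp2l.
    rewrite ed mulnC; apply: dvdn_mul; first exact: dvdn_exp2l.
    have : (e %| p ^ k.+1 * q)%N by apply: dvdn_trans dN; rewrite [X in (_ %| X)%N]ed dvdn_mulr.
    by rewrite Gauss_dvdr // coprime_sym coprimeXl.
  split; first by rewrite expnS -mulnA dvdn_mull.
  apply/negP => pd; have := dvdn_trans pd dk.
  rewrite expnSr dvdn_pmul2l ?expn_gt0 ?p0 // => pq'.
  by move: pq; rewrite prime_coprime // pq'.
rewrite /g (bigID (fun d => p ^ k.+1 %| d)%N) /= addrC; congr (_ + _).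
  rewrite (eq_bigl _ _ key) (@big_cat_nat _ _ _ (p ^ k * q).+1) //=; last first.
    by rewrite ltnS leq_mul2r expnS leq_pmull ?orbT.
  rewrite [X in _ + X]big1_seq ?addr0 // => d.
  rewrite mem_index_iota => /andP[/dvdn_leq]; rewrite muln_gt0 expn_gt0 p0 q0 /= => /(_ isT).
  by move=> h /andP[h2 _]; move: (leq_trans h2 h); rewrite ltnn.
rewrite (eq_bigl (fun d => (p ^ k.+1 %| d) && (d %| p ^ k.+1 * q))%N); last by move=> d; rewrite andbC.
rewrite big_mkcondr /= (@big_multiples R _ _ (fun d => if (d %| p ^ k.+1 * q)%N then chi d else 0)) //.
rewrite mulKn // mulr_sumr [RHS]big_mkcond; apply: eq_bigr => e _.
by rewrite dvdn_pmul2l //; case: ifP => // _; rewrite chiM chiX.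
Qed.

Lemma chi_divisor_sum_pow (p k q : nat) : prime p -> coprime p q -> (0 < q)%N ->
  g (p ^ k * q) = g q * \sum_(0 <= j < k.+1) chi p ^+ j.
Proof.
move=> pp pq q0; elim: k => [|k IH]; first by rewrite expn0 mul1n big_nat1 expr0 mulr1.
by rewrite chi_divisor_sum_step // IH [in RHS]big_nat_recr //= mulrDr [chi p ^+ _ * _]mulrC.
Qed.

(** The extreme case is [chi p = -1], where the sums alternate between 1 and 0. *)
Lemma geometric_sum_ge (p k : nat) : (~~ odd k)%:R <= \sum_(0 <= j < k.+1) chi p ^+ j.
Proof.
have h (x : R) : x = 0 \/ x = 1 \/ x = -1 -> (~~ odd k)%:R <= \sum_(0 <= j < k.+1) x ^+ j.
  case=> [->|[->|->]].
  - rewrite big_ltn // expr0 big1_seq ?addr0; first by case: odd.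
    by move=> j; rewrite mem_index_iota expr0n => /andP[_]; case: j.
  - under eq_bigr do rewrite expr1n.
    by rewrite sumr_const_nat subn0 ler_nat; case: odd.
  elim: k => [|k IH]; first by rewrite big_nat1 expr0.
  have e i : \sum_(0 <= j < i.+1) (-1) ^+ j = (~~ odd i)%:R :> R.
    elim: i => [|i IHi]; first by rewrite big_nat1 expr0.
    rewrite big_nat_recr //= IHi -signr_odd /=; case: (odd i) => /=.
      by rewrite expr0 add0r.
    by rewrite expr1 subrr.
  by rewrite e.
by case: (chi_values chi_unit chi_zero p) => hp; apply: h; [left|right; left|right; right].
Qed.

Lemma chi_divisor_sum1 : g 1 = 1.
Proof. by rewrite /g big_mkcond big_nat1 /= (chi_1 chiM chi_unit). Qed.

Lemma chi_divisor_sum_ge0 n : 0 <= g n.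
Proof.
elim/ltn_ind: n => n IH; have [n1|n1] := leqP n 1.
  case: n n1 {IH} => [|[|//]] _; first by rewrite /g big_geq.
  by rewrite chi_divisor_sum1.
have n0 : (0 < n)%N by apply: ltnW.
have pp := pdiv_prime n1; have [q pq eq] := pfactor_coprime pp n0.
have q0 : (0 < q)%N by move: n0; rewrite {1}eq muln_gt0 => /andP[].
rewrite eq mulnC chi_divisor_sum_pow // mulr_ge0 //.
  apply: IH; rewrite [X in (_ < X)%N]eq ltn_Pmulr //.
  by rewrite -[1%N](expn0 (pdiv n)) ltn_exp2l ?prime_gt1 // logn_gt0 mem_primes pp n0 pdiv_dvd.
by apply: le_trans (geometric_sum_ge _ _); case: odd.
Qed.

Lemma chi_divisor_sum_sq n : (0 < n)%N -> 1 <= g (n ^ 2).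
Proof.
elim/ltn_ind: n => n IH n0; have [n1|n1] := leqP n 1.
  by have -> : n = 1%N by [lia]; rewrite exp1n chi_divisor_sum1.
have pp := pdiv_prime n1; have [q pq eq] := pfactor_coprime pp n0.
have q0 : (0 < q)%N by move: n0; rewrite {1}eq muln_gt0 => /andP[].
rewrite eq mulnC expnMn -expnM chi_divisor_sum_pow ?coprimeXr ?expn_gt0 ?q0 //.
rewrite -[1]mulr1; apply: ler_pM => //.
  apply: IH => //; rewrite [X in (_ < X)%N]eq ltn_Pmulr //.
  by rewrite -[1%N](expn0 (pdiv n)) ltn_exp2l ?prime_gt1 // logn_gt0 mem_primes pp n0 pdiv_dvd.
by apply: le_trans (geometric_sum_ge _ _); rewrite oddM andbF.
Qed.

Variable u : nat.
Hypothesis um : coprime u m.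
Hypothesis chi_u : chi u = -1.

(** Exchange the sums and apply [lambert_term]. The three terms come from the [1 / d] part, from the
    weights by Abel summation (the first weight is 1), and from the truncated tails. Only the first
    could grow as [t] tends to 1 with [K] large, and it is harmless if the L-series sums to 0. *)
Lemma lambert_upper (t : R) (K : nat) : 0 < t < 1 -> (0 < K)%N ->
  \sum_(1 <= n < K.+1) g n * t ^+ n <=
  `|dirichlet_partial chi K| / (1 - t) + 2 * m%:R + K%:R * t ^+ K / (1 - t).
Proof.
move=> t01 K0; have /andP[t0 t1] := t01; have t1' : 0 < 1 - t by rewrite subr_gt0.
have -> : \sum_(1 <= n < K.+1) g n * t ^+ n =
  \sum_(1 <= d < K.+1) chi d * \sum_(1 <= e < (K %/ d).+1) t ^+ (d * e).
  transitivity (\sum_(1 <= n < K.+1) \sum_(1 <= d < K.+1 | (d %| n)%N) chi d * t ^+ n).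
    apply: eq_big_nat => n /andP[n0 nK]; rewrite /g mulr_suml.
    rewrite [RHS](@big_cat_nat _ _ _ n.+1) //= [X in _ = _ + X]big1_seq ?addr0 // => d.
    by rewrite mem_index_iota => /andP[/dvdn_leq - /(_ n0) h /andP[h2 _]]; move: (leq_trans h2 h); rewrite ltnn.
  rewrite (exchange_big_dep xpredT) //=; apply: eq_big_nat => d /andP[d0 _].
  by rewrite -mulr_sumr (@big_multiples R _ _ (fun n => t ^+ n)).
have -> : \sum_(1 <= d < K.+1) chi d * \sum_(1 <= e < (K %/ d).+1) t ^+ (d * e) =
  dirichlet_partial chi K / (1 - t) - \sum_(1 <= d < K.+1) chi d * lambert_weight t d -
  \sum_(1 <= d < K.+1) chi d * (t ^+ (d * (K %/ d).+1) / ((1 - t) * \sum_(0 <= i < d) t ^+ i)).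
  rewrite /dirichlet_partial mulr_suml -!sumrB; apply: eq_big_nat => d /andP[d0 _].
  by rewrite (lambert_term t01 _ d0) !mulrBr; congr (_ - _ - _); rewrite mulrA.
apply: le_trans (ler_norm _) _.
apply: le_trans (ler_normB _ _) _; apply: lerD.
  apply: le_trans (ler_normB _ _) _; apply: lerD.
    by rewrite normrM normfV (ger0_norm (ltW t1')).
  have h : `|\sum_(1 <= d < K.+1) chi d * lambert_weight t d| <= 2 * m%:R * lambert_weight t 1.
    apply: (chi_abel m0 chiM chi_per chi_unit chi_zero um chi_u) => //.
      by move=> k k1; apply: lambert_weight_dec.
    by rewrite lambert_weight1.
  by rewrite (lambert_weight1 t01) mulr1 in h.
apply: le_trans (ler_norm_sum _ _ _) _.
apply: (@le_trans _ _ (\sum_(1 <= d < K.+1) t ^+ K / (1 - t))); last first.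
  by rewrite sumr_const_nat subn1 /= -[leLHS]mulr_natl mulrA.
rewrite !big_seq; apply: ler_sum => d; rewrite mem_index_iota => /andP[d0 _].
have Sd := lambert_geom_gt0 t01 d0.
have Sd1 : 1 <= \sum_(0 <= i < d) t ^+ i.
  rewrite big_ltn // expr0 lerDl; apply: sumr_ge0 => i _; rewrite exprn_ge0 // ltW //.
have x0 : 0 <= t ^+ (d * (K %/ d).+1) / ((1 - t) * \sum_(0 <= i < d) t ^+ i).
  by rewrite divr_ge0 ?exprn_ge0 ?mulr_ge0 // ltW.
rewrite normrM (ger0_norm x0); apply: le_trans (ler_piMl x0 (chi_norm_le1 chi_unit chi_zero d)) _.
apply: ler_pM; rewrite ?exprn_ge0 ?(ltW t0) //.
- by rewrite invr_ge0 mulr_ge0 // ltW.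
- by apply: ler_wiXn2l; rewrite ?(ltW t0) ?(ltW t1) // ltnW // mulnC -ltn_divLR.
by rewrite lef_pV2 ?posrE ?mulr_gt0 // ler_peMr // ltW.
Qed.

Lemma lambert_lower (t : R) (s K : nat) : 0 < t < 1 -> (s ^ 2 <= K)%N ->
  s%:R * t ^+ (s ^ 2) <= \sum_(1 <= n < K.+1) g n * t ^+ n.
Proof.
move=> /andP[t0 t1] sK.
have a0 n : 0 <= g n * t ^+ n by rewrite mulr_ge0 ?chi_divisor_sum_ge0 // exprn_ge0 // ltW.
apply: (@le_trans _ _ (\sum_(1 <= j < s.+1) g (j ^ 2) * t ^+ (j ^ 2))).
  rewrite mulr_natl.
  have -> : t ^+ (s ^ 2) *+ s = \sum_(1 <= j < s.+1) t ^+ (s ^ 2).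
    by rewrite sumr_const_nat subn1.
  rewrite !big_seq; apply: ler_sum => j; rewrite mem_index_iota => /andP[j0 js].
  rewrite -[leLHS]mul1r; apply: ler_pM => //; first by rewrite exprn_ge0 // ltW.
    exact: chi_divisor_sum_sq.
  by apply: ler_wiXn2l; rewrite ?(ltW t0) ?(ltW t1) // leq_exp2r.
apply: (@le_trans _ _ (\sum_(1 <= n < (s ^ 2).+1) g n * t ^+ n)); last first.
  by rewrite [leRHS](@big_cat_nat _ _ _ (s ^ 2).+1) //= lerDl sumr_ge0.
elim: s {sK} => [|s IH]; first by rewrite !big_geq.
rewrite big_nat_recr //= [leRHS](@big_cat_nat _ _ _ (s ^ 2).+1) //=; last first.
  by rewrite ltnS leq_exp2r.
apply: lerD => //.
have ss : (s ^ 2 < s.+1 ^ 2)%N by rewrite ltn_exp2r.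
by rewrite big_nat_recr //= lerDr sumr_ge0.
Qed.

(* If [L = 0], the Lambert series [sum g(n) t^n] stays bounded as [t] tends to 1,
   although [g >= 0] and [g (j ^ 2) >= 1] (Monsky). *)
Lemma dirichlet_L_neq0 (L : R) :
  (forall N, `|dirichlet_partial chi N - L| <= 2 * m%:R / N.+1%:R) -> L != 0.
Proof.
move=> hL; apply/eqP => L0.
(* With [t = 1 - 1 / X], [t ^ X] lies between 1/4 and 1/2. The squares then contribute at least
   [s / 4 = 4 m + 2], whereas the upper bound is [2 m + 2 m + 1]; the choice [K = 4 X ^ 2] makes the
   truncation term at most 1. *)
pose s := (4 * (4 * m + 2))%N; pose X := (s ^ 2)%N.
have s0 : (0 < s)%N by rewrite /s muln_gt0 /= addn2.
have eX : X = (s * s)%N by rewrite /X -mulnn.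
have X2 : (16 <= X)%N by rewrite eX /s; nia.
have XR : (0 : R) < X%:R by rewrite ltr0n; apply: leq_trans X2.
pose t : R := 1 - X%:R^-1.
have X2R : (2 : R) <= X%:R by rewrite ler_nat; apply: leq_trans X2.
have Xi : X%:R^-1 <= 2^-1 :> R by rewrite lef_pV2 ?posrE.
have Xi0 : 0 < X%:R^-1 :> R by rewrite invr_gt0.
have t01 : 0 < t < 1 by rewrite /t; lra.
have t1 : 1 - t = X%:R^-1 by rewrite /t; ring.
pose K := (X * (4 * X))%N.
have K0 : (0 < K)%N by rewrite /K; move: X2; clear; nia.
(* Bernoulli at exponent [X] would only give 0; it is applied at [X./2] and the result is
   squared. *)
have low : 4^-1 <= t ^+ X.
  have eX2 : X = ((X./2) * 2)%N by rewrite eX /s; lia.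
  have h : 2^-1 <= t ^+ X./2.
    have := @bernoulli_ineq R (- X%:R^-1) X./2; rewrite -/t => /(_ ltac:(lra)).
    apply: le_trans; rewrite [in X in _ <= _ + _ * - X]eX2 natrM mulrN invfM mulrA divff.
      by rewrite mul1r; lra.
    by rewrite pnatr_eq0; lia.
  rewrite eX2 exprM (_ : 4^-1 = 2^-1 ^+ 2); last by field.
  by rewrite lerXn2r ?nnegrE // exprn_ge0 //; case/andP: t01 => /ltW.
have hX : t ^+ X <= 2^-1.
  have Xm : (0 : R) < X%:R - 1 by lra.
  have e : t = (1 + (X%:R - 1)^-1)^-1 by rewrite /t; field; rewrite subrK !gt_eqF.
  have h := @bernoulli_ineq R (X%:R - 1)^-1 X.
  have {}h : 2 <= (1 + (X%:R - 1)^-1) ^+ X :> R.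
    have hm : -1 <= (X%:R - 1)^-1 :> R.
      by apply: (@le_trans _ _ 0); rewrite ?lerN10 // invr_ge0 ltW.
    have {}h := h hm; apply: (le_trans _ h).
    have : 1 <= X%:R / (X%:R - 1) :> R by rewrite ler_pdivlMr // mul1r; lra.
    by lra.
  rewrite e exprVn lef_pV2 ?posrE //; apply: lt_le_trans h; lra.
have up : K%:R * t ^+ K / (1 - t) <= 1.
  rewrite t1 invrK /K mulrAC -natrM exprM.
  apply: (@le_trans _ _ ((16 ^ X)%:R * 2^-1 ^+ (4 * X))).
    apply: ler_pM => //.
    - by rewrite !exprn_ge0 //; case/andP: t01 => /ltW.
    - have e16 : (16 ^ X = (2 ^ X) ^ 4)%N by rewrite -[16%N]/(2 ^ 4)%N -!expnM mulnC.
      rewrite ler_nat e16.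
      apply: (@leq_trans (X.+1 ^ 4)); last by rewrite leq_exp2r // ltn_expl.
      by rewrite !expnS expn0; clear; nia.
    by rewrite lerXn2r ?nnegrE // exprn_ge0 //; case/andP: t01 => /ltW.
  by rewrite natrX exprM -exprMn (_ : 16 * 2^-1 ^+ 4 = 1) ?expr1n //; field.
have := lambert_upper t01 K0.
have XK : (X <= K)%N by rewrite /K; move: X2; clear; nia.
have := @lambert_lower t s K t01 XK.
set T := \sum_(_ <= _ < _) _ => h1 h2.
have h3 : `|dirichlet_partial chi K| / (1 - t) <= 2 * m%:R.
  have := hL K; rewrite L0 subr0 t1 invrK => h.
  apply: le_trans (ler_wpM2r (ltW XR) h) _.
  rewrite mulrAC ler_pdivrMr ?ltr0n // ler_wpM2l ?mulr_ge0 // ler_nat.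
  exact: leqW.
have h4 : s%:R / 4 <= s%:R * t ^+ X by rewrite ler_wpM2l.
have e : s%:R / 4 = 4 * m%:R + 2 :> R by rewrite /s natrM natrD natrM; field.
move: h1 h2 h3 h4 up; rewrite e -/X; lra.
Qed.
End NonVanishing.

(** * Primes with prescribed real characters *)

(** Nothing is required at arguments not coprime to [m], so symbols of smaller period qualify for a
    common modulus; [real_character_restrict] sets those values to 0. The principal character is
    allowed. *)
Definition real_character (R : nzRingType) (m : nat) (chi : nat -> R) : Prop :=
  [/\ forall a b, chi (a * b)%N = chi a * chi b,
      forall a, chi (a + m)%N = chi a
    & forall a, coprime a m -> chi a = 1 \/ chi a = -1].

Section PrimesWithCharacters.
Variables (R : realType) (m : nat).
Hypothesis m0 : (0 < m)%N.

Definition primitive_support (chi : nat -> R) := forall a, ~~ coprime a m -> chi a = 0.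

Lemma real_character_restrict (chi : nat -> int) : real_character m chi ->
  let c a : R := if coprime a m then (chi a)%:~R else 0 in
  real_character m c /\ primitive_support c.
Proof.
case=> hM hper hu c; split; last by move=> a /negbTE; rewrite /c => ->.
split.
- move=> a b; rewrite /c coprimeMl hM rmorphM.
  by case: (coprime a m); case: (coprime b m); rewrite /= ?mul0r ?mulr0.
- by move=> a; rewrite /c hper -coprime_modl modnDr coprime_modl.
move=> a am; rewrite /c am; by case: (hu a am) => ->; [left|right].
Qed.

Lemma real_character_mul (c1 c2 : nat -> R) :
  real_character m c1 /\ primitive_support c1 ->
  real_character m c2 /\ primitive_support c2 ->
  real_character m (fun a => c1 a * c2 a) /\ primitive_support (fun a => c1 a * c2 a).
Proof.
move=> [[M1 p1 u1] z1] [[M2 p2 u2] z2]; split; last by move=> a /z1 ->; rewrite mul0r.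
split=> [a b|a|a am].
- by rewrite M1 M2 mulrACA.
- by rewrite p1 p2.
case: (u1 a am) => ->; case: (u2 a am) => ->; rewrite ?mul1r ?mulr1 ?mulrNN ?mulr1; by [left|right].
Qed.

Local Notation wsum f N := (\sum_(1 <= d < N.+1) f d * (mangoldt R d / d%:R)).

Lemma weight_ge0 d : 0 <= mangoldt R d / d%:R.
Proof. by rewrite divr_ge0 ?mangoldt_ge0. Qed.

(** Either [c] takes the value -1 at a unit and the sum is bounded by [mertens_chi], or [c] is
    principal and the sum is nonnegative. A one-sided bound covers both cases. *)
Lemma real_character_bounded_below (c : nat -> R) (u : nat) : coprime u m ->
  real_character m c /\ primitive_support c ->
  exists C : R, forall N, - C <= c u * wsum c N.
Proof.
move=> um [[hM hp hu] hz].
have [[v [vm cv]]|nv] := pselect (exists v, coprime v m /\ c v = -1).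
  have [L hL] := dirichlet_L_exists m0 hM hp hu hz vm cv.
  have L0 := dirichlet_L_neq0 m0 hM hp hu hz vm cv hL.
  have [C hC] := mertens_chi m0 hM hp hu hz vm cv L0 hL.
  exists C => N; have := hC N; under eq_bigr do rewrite -mulrA.
  move: (\sum_(_ <= _ < _) _) => S; rewrite ler_norml => /andP[h1 h2].
  by case: (hu u um) => ->; rewrite ?mul1r ?mulN1r //; lra.
have c1 a : coprime a m -> c a = 1.
  by move=> am; case: (hu a am) => // ca; case: nv; exists a.
exists 0 => N; rewrite oppr0 c1 // mul1r; apply: sumr_ge0 => d _.
rewrite mulr_ge0 ?weight_ge0 //; have [dm|dm] := boolP (coprime d m); first by rewrite c1.
by rewrite hz.
Qed.

Variables (I : eqType) (c : I -> nat -> R) (u : nat).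
Hypothesis um : coprime u m.
(* For [d] coprime to [m] this vanishes unless [c i d = c i u] for all [i] in [s]. *)
Definition match_product (s : seq I) (d : nat) : R := \prod_(i <- s) (1 + c i u * c i d).

(** Each factor [1 + c i u * c i d] splits the sum in two; the character [psi] absorbs [c i], which
    is why the induction is over all [psi]. *)
Lemma match_product_bounded_below (s : seq I) (psi : nat -> R) :
  {in s, forall i, real_character m (c i) /\ primitive_support (c i)} ->
  real_character m psi /\ primitive_support psi ->
  exists C : R, forall N, - C <= psi u * wsum (fun d => psi d * match_product s d) N.
Proof.
elim: s psi => [|i s IH] psi hs hpsi.
  have [C hC] := real_character_bounded_below um hpsi; exists C => N.
  by under eq_bigr do rewrite /match_product big_nil mulr1.
have hs' : {in s, forall i, real_character m (c i) /\ primitive_support (c i)}.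
  by move=> j js; apply: hs; rewrite inE js orbT.
have hi : real_character m (c i) /\ primitive_support (c i) by apply: hs; rewrite inE eqxx.
have [C1 h1] := IH psi hs' hpsi.
have [C2 h2] := IH _ hs' (real_character_mul hpsi hi).
exists (C1 + C2) => N; have := lerD (h1 N) (h2 N); rewrite -opprD.
move=> h; apply: (le_trans h); rewrite !mulr_sumr -big_split /=.
rewrite le_eqVlt; apply/orP; left; apply/eqP; apply: eq_bigr => d _.
by rewrite /match_product big_cons; ring.
Qed.

(** On expanding the product, the constant 1 supplies [ln N], and everything else is bounded
    below. *)
Lemma match_product_diverges (s : seq I) :
  {in s, forall i, real_character m (c i) /\ primitive_support (c i)} ->
  exists C : R, forall N, (0 < N)%N -> ln N%:R - C <= wsum (match_product s) N.
Proof.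
elim: s => [|i s IH] hs.
  exists 1 => N N0; apply: le_trans (ln_le_sum_mangoldt R N0) _.
  by under [leRHS]eq_bigr do rewrite /match_product big_nil mul1r.
have hs' : {in s, forall i, real_character m (c i) /\ primitive_support (c i)}.
  by move=> j js; apply: hs; rewrite inE js orbT.
have hi : real_character m (c i) /\ primitive_support (c i) by apply: hs; rewrite inE eqxx.
have [C1 h1] := IH hs'; have [C2 h2] := match_product_bounded_below hs' hi.
exists (C1 + C2) => N N0; have h := lerD (h1 N N0) (h2 N); rewrite opprD addrA.
apply: (le_trans h); rewrite mulr_sumr -big_split /=.
rewrite le_eqVlt; apply/orP; left; apply/eqP; apply: eq_bigr => d _.
by rewrite /match_product big_cons; ring.
Qed.

Lemma match_product_ge0_le (s : seq I) d :
  {in s, forall i, real_character m (c i) /\ primitive_support (c i)} ->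
  0 <= match_product s d <= 2 ^+ size s.
Proof.
elim: s => [|i s IH] hs; first by rewrite /match_product big_nil expr0 ler01 lexx.
have hs' : {in s, forall i, real_character m (c i) /\ primitive_support (c i)}.
  by move=> j js; apply: hs; rewrite inE js orbT.
have [[_ _ hu] hz] : real_character m (c i) /\ primitive_support (c i) by apply: hs; rewrite inE eqxx.
have /andP[h0 h1] := IH hs'; rewrite /match_product big_cons -/(match_product s d).
have : 0 <= 1 + c i u * c i d <= 2.
  have [x1 x2] : [\/ c i u = 0, c i u = 1 | c i u = -1] /\ [\/ c i d = 0, c i d = 1 | c i d = -1].
    by split; apply: chi_values hu hz _.
  by case: x1 => ->; case: x2 => ->; lra.
move=> /andP[f0 f1]; rewrite mulr_ge0 //=.
by rewrite exprS ler_pM.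
Qed.

Lemma match_product_prime (s : seq I) d :
  {in s, forall i, real_character m (c i) /\ primitive_support (c i)} -> coprime d m ->
  match_product s d != 0 -> {in s, forall i, c i d = c i u}.
Proof.
move=> hs dm; rewrite /match_product prodf_seq_neq0 => /allP h i si.
have := h i si => /=; have [[_ _ hu] _] := hs i si.
case: (hu u um) => ->; case: (hu d dm) => -> //; rewrite ?mulr1 ?mul1r ?mulN1r ?opprK => /eqP[];
  by rewrite subrr.
Qed.
End PrimesWithCharacters.

(** Without such a prime, the weighted sum of [match_product] is supported on nonprimes and on
    [d <= m], where all primes dividing [m] lie. It would then be bounded, against
    [match_product_diverges]. *)
Lemma exists_prime_real_characters (R : realType) (I : eqType) (s : seq I)
    (chi : I -> nat -> int) (m u : nat) :
  (0 < m)%N -> coprime u m -> {in s, forall i, real_character m (chi i)} ->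
  exists q, [/\ prime q, coprime q m & {in s, forall i, chi i q = chi i u}].
Proof.
move=> m0 um hs; pose c i a : R := if coprime a m then (chi i a)%:~R else 0.
have hc : {in s, forall i, real_character m (c i) /\ primitive_support m (c i)}.
  by move=> i si; apply: real_character_restrict (hs i si).
apply: contrapT => nq.
have no d : prime d -> coprime d m -> match_product c u s d = 0.
  move=> pd dm; apply/eqP; apply: contrapT => /negP nz; apply: nq; exists d; split=> // i si.
  have := match_product_prime um hc dm nz si; rewrite /c dm um => /eqP.
  by rewrite eqr_int => /eqP.
have [C hC] := match_product_diverges m0 um hc.
pose B : R := 2 ^+ size s; have B0 : 0 <= B by rewrite exprn_ge0.
pose M : R := \sum_(1 <= d < m.+1) mangoldt R d / d%:R.
have up N : \sum_(1 <= d < N.+1) match_product c u s d * (mangoldt R d / d%:R) <= B * (M + 2).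
  have w0 d : 0 <= mangoldt R d / d%:R by apply: weight_ge0.
  apply: (@le_trans _ _ (B * (\sum_(1 <= d < N.+1 | (d <= m)%N) mangoldt R d / d%:R +
      \sum_(1 <= d < N.+1 | ~~ prime d) mangoldt R d / d%:R))).
    rewrite [X in X + _]big_mkcond [X in _ + X]big_mkcond -big_split /= mulr_sumr !big_seq.
    apply: ler_sum => d; rewrite mem_index_iota => /andP[d0 _].
    have /andP[f0 f1] := match_product_ge0_le u d hc.
    case: ifP => dm; [|case: ifP => pd].
    - apply: ler_pM => //; rewrite lerDl; case: ifP => // _.
    - by rewrite add0r ler_pM.
    rewrite addr0 mulr0 no ?mul0r //; first by move/negbT: pd; rewrite negbK.
    rewrite prime_coprime; last by move/negbT: pd; rewrite negbK.
    by apply/negP => /(dvdn_leq m0); rewrite dm.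
  rewrite ler_wpM2l // lerD ?sum_mangoldt_nonprime //.
  have [Nm|mN] := leqP N m.
    rewrite /M [leRHS](@big_cat_nat _ _ _ N.+1) //= -[leLHS]addr0 lerD ?sumr_ge0 //.
    by rewrite big_mkcond; apply: ler_sum => d _; case: ifP.
  rewrite (@big_cat_nat _ _ _ m.+1) //=; last by rewrite ltnW.
  rewrite [X in _ + X]big1_seq ?addr0; last first.
    by move=> d; rewrite mem_index_iota => /andP[h1 /andP[h2 _]]; move: (leq_trans h2 h1); rewrite ltnn.
  by rewrite /M big_mkcond; apply: ler_sum => d _; case: ifP.
(* At [N = 2 ^ k] with [k > x], the estimate [ln 2 >= 1/2] gives [ln N > C + B * (M + 2)]. *)
pose x := Num.max 0 (2 * (C + B * (M + 2))).
have xb : x < (Num.bound x)%:R by apply: archi_boundP; rewrite le_max lexx.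
set k := Num.bound x in xb.
have := le_trans (hC (2 ^ k)%N _) (up (2 ^ k)%N); rewrite expn_gt0 => /(_ isT).
rewrite natrX lnXn // => h.
have ln2 : 2^-1 <= ln 2 :> R.
  have := @ln_le_subr1 R 2^-1; rewrite invr_gt0 ltr0n lnV ?posrE // => /(_ isT); lra.
have : k%:R * 2^-1 <= ln 2 *+ k :> R by rewrite -[leRHS]mulr_natl ler_wpM2l.
have : 2 * (C + B * (M + 2)) <= x by rewrite le_max lexx orbT.
move: h xb; lra.
Qed.

(** * Quadratic reciprocity *)

Section QuadraticResidues.
Local Open Scope nat_scope.

Definition legendre (p a : nat) : int :=
  if p %| a then 0%R else
  if [exists x : 'I_p, x ^ 2 == a %[mod p]] then 1%R else (-1)%R.

Lemma legendre_mod p a : legendre p (a %% p) = legendre p a.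
Proof. by rewrite /legendre /dvdn; under eq_existsb do rewrite modn_mod; rewrite modn_mod. Qed.

Lemma legendre_sq p a x : x ^ 2 = a %[mod p] -> 0 < p -> ~~ (p %| a) -> legendre p a = 1%R.
Proof.
move=> xa p0 pa; rewrite /legendre (negbTE pa) ifT //.
apply/existsP; exists (Ordinal (ltn_pmod x p0)); apply/eqP.
by rewrite /= modnXm.
Qed.

Lemma legendre_eq1 p a : legendre p a = 1%R -> exists x : nat, x ^ 2 = a %[mod p].
Proof.
rewrite /legendre; case: (p %| a) => //; case: ifP => // /existsP[x /eqP xa] _.
by exists x.
Qed.

Lemma Fp_nat_eq p (a b : nat) : prime p ->
  ((a%:R : 'F_p) == b%:R)%R = (a == b %[mod p]).
Proof.
move=> pp; apply/eqP/eqP => [/(congr1 val)|ab].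
  by rewrite /= !val_Fp_nat.
by apply/val_inj; rewrite /= !val_Fp_nat.
Qed.

Lemma euler_criterion p a : prime p -> odd p ->
  ((a%:R : 'F_p) ^+ p./2 = (legendre p a)%:~R)%R.
Proof.
move=> pp op.
have p2 : p = p./2.*2.+1 by rewrite -[LHS]odd_double_half op.
have h0 : 0 < p./2 by move: (prime_gt1 pp); lia.
have a0 : ((a%:R : 'F_p) == 0)%R = (p %| a).
  by rewrite -[0%R]/(0%:R)%R Fp_nat_eq // mod0n.
have sq1 (x : 'F_p) : (x != 0 -> (x ^+ 2) ^+ p./2 = 1)%R.
  move=> x0; apply: (mulfI x0); rewrite mulr1 -exprM mul2n -exprS -p2.
  rewrite -[in LHS](natr_Zp x) -natrX -[in RHS](natr_Zp x); apply/eqP.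
  by have := Fp_nat_eq (x ^ p) x pp; rewrite fermat_little // eqxx => E; exact: E.
rewrite /legendre; case: ifP => [pa|pa].
  have /eqP -> : ((a%:R : 'F_p) == 0)%R by rewrite a0.
  by rewrite expr0n eqn0Ngt h0.
have an0 : ((a%:R : 'F_p) != 0)%R by rewrite a0 pa.
case: ifP => [/existsP[x xa]|nsq].
  have xa' : ((x%:R : 'F_p) ^+ 2 = a%:R)%R.
    by apply/eqP; rewrite -natrX Fp_nat_eq.
  rewrite -xa' sq1 //; apply: contraNneq an0 => x0.
  by rewrite -xa' x0 expr0n.
have : (((a%:R : 'F_p) ^+ p./2) ^+ 2 == 1)%R by rewrite -exprM mulnC exprM sq1.
rewrite sqrf_eq1 => /orP[/eqP h1|/eqP //].
exfalso.
(* A nonresidue with power 1 would be a root of [P] besides the [p./2] distinct squares, one more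
   than the degree permits. *)
pose P := ('X^(p./2) - 1%:P : {poly 'F_p})%R.
have sP : size P = p./2.+1 by rewrite size_XnsubC.
pose rs := (a%:R)%R :: [seq ((k%:R : 'F_p) ^+ 2)%R | k <- iota 1 p./2].
have P0 : P != 0%R by rewrite -size_poly_eq0 sP.
have := @max_poly_roots _ P rs P0.
rewrite sP /= size_map size_iota ltnn => H.
have knz k : k \in iota 1 p./2 -> ((k%:R : 'F_p) != 0)%R.
  rewrite mem_iota => hk; rewrite -[0%R]/(0%:R)%R Fp_nat_eq // mod0n.
  rewrite modn_small; lia.
suff : false by []. apply: H.
- apply/andP; split.
    by rewrite /root /P !hornerE h1 subrr.
  apply/allP => y /mapP[k hk ->].
  by rewrite /root /P !hornerE sq1 ?subrr ?knz.
- apply/andP; split.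
    apply/mapP => -[k hk /eqP]; rewrite -natrX Fp_nat_eq // => ka.
    move/negbT: nsq; rewrite negb_exists => /forallP.
    have kp : k < p by move: hk; rewrite mem_iota; lia.
    by move/(_ (Ordinal kp)); rewrite /= eq_sym ka.
  rewrite map_inj_in_uniq ?iota_uniq // => k l hk hl /eqP.
  rewrite -subr_eq0 subr_sqr mulf_eq0 => /orP[].
    rewrite subr_eq0 Fp_nat_eq // !modn_small => [/eqP//||];
    by move: hk hl; rewrite !mem_iota; lia.
  rewrite -natrD -[0%R]/(0%:R)%R Fp_nat_eq // mod0n modn_small.
    by move: hk hl; rewrite !mem_iota; lia.
  by move: hk hl; rewrite !mem_iota; lia.
Qed.

Lemma legendre_pm1 p a : ~~ (p %| a) -> legendre p a = 1%R \/ legendre p a = (-1)%R.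
Proof. by rewrite /legendre => /negbTE ->; case: ifP; [left|right]. Qed.

(** As 0, 1 and -1 are distinct in ['F_p], identities between Legendre symbols can be checked there,
    where Euler's criterion makes them powers. *)
Lemma Fp_sign_inj p (x y : int) : prime p -> odd p ->
  (x \in [:: 0; 1; -1] -> y \in [:: 0; 1; -1] ->
   x%:~R = y%:~R :> 'F_p -> x = y)%R.
Proof.
move=> pp op.
have n1 : ((1 : 'F_p) != 0)%R by rewrite oner_eq0.
have n2 : ((1 : 'F_p) != -1)%R.
  rewrite -subr_eq0 opprK -[(1 + 1)%R]/(2%:R)%R -[0%R]/(0%:R)%R Fp_nat_eq // mod0n.
  by rewrite modn_small //; move: op (prime_gt1 pp); case: p {pp n1} => [|[|[|]]].
have n3 : ((-1 : 'F_p) != 0)%R by rewrite oppr_eq0.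
rewrite !inE => /or3P[] /eqP -> /or3P[] /eqP -> //=;
  rewrite ?mulrNz ?mulr0z ?mulr1z => /eqP;
  by rewrite ?(negbTE n1) ?(negbTE n2) ?(negbTE n3) // eq_sym ?(negbTE n1) ?(negbTE n2) ?(negbTE n3).
Qed.

Lemma legendre_in p a : (legendre p a \in [:: 0; 1; -1])%R.
Proof. by rewrite /legendre; case: ifP => // _; case: ifP. Qed.

Lemma legendreM p a b : prime p -> odd p ->
  legendre p (a * b) = (legendre p a * legendre p b)%R.
Proof.
move=> pp op; apply: (Fp_sign_inj pp op); rewrite ?legendre_in //.
  by move: (legendre_in p a) (legendre_in p b); rewrite !inE =>
    /or3P[] /eqP -> /or3P[] /eqP ->.
by rewrite -euler_criterion // natrM exprMn !euler_criterion // rmorphM.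
Qed.

Lemma signr_odd_inj m n : ((-1) ^+ m = (-1) ^+ n :> int)%R <-> odd m = odd n.
Proof.
split; last by rewrite -signr_odd => ->; rewrite signr_odd.
by rewrite -signr_odd -[in RHS]signr_odd; case: (odd m); case: (odd n).
Qed.

Lemma legendre_sign p a n : prime p -> odd p ->
  ((a%:R : 'F_p) ^+ p./2 = (-1) ^+ n)%R -> legendre p a = ((-1) ^+ n)%R.
Proof.
move=> pp op h; apply: (Fp_sign_inj pp op); rewrite ?legendre_in //.
  by rewrite -signr_odd; case: odd.
by rewrite -euler_criterion // h rmorphXn /= mulrNz mulr1z.
Qed.

Lemma legendre_pred p : prime p -> odd p -> legendre p p.-1 = ((-1) ^+ p./2)%R.
Proof.
move=> pp op; apply: legendre_sign => //; congr (_ ^+ _)%R.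
apply/eqP; rewrite -subr_eq0 opprK -[1%R]/(1%:R)%R -natrD addn1 prednK ?prime_gt0 //.
by rewrite -[0%R]/(0%:R)%R Fp_nat_eq // modnn mod0n.
Qed.

(** * Gauss's lemma and Eisenstein's form of it *)

Section GaussLemma.
Variables (p a : nat).
Hypotheses (pp : prime p) (op : odd p) (pa : ~~ (p %| a)).
Let h := p./2.
Let r k := (a * k) %% p.
Let s k := if h < r k then p - r k else r k.

Let p2 : p = h.*2.+1. Proof. by rewrite -[LHS]odd_double_half op. Qed.

(** [s k] is the absolute least residue of [a * k]. If [s k = s l], then [p] divides [k - l] or
    [k + l], and the latter is positive and below [p]. *)
Lemma gauss_residue_perm : perm_eq [seq s k | k <- iota 1 h] (iota 1 h).
Proof.
have rlt k : r k < p by rewrite ltn_mod prime_gt0.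
have r0 k : k \in iota 1 h -> 0 < r k.
  rewrite mem_iota => hk; rewrite lt0n; apply/negP => /eqP rk.
  have : p %| a * k by rewrite /dvdn -/(r k) rk.
  by rewrite Euclid_dvdM // (negbTE pa) /= => /dvdn_leq; lia.
have us : uniq [seq s k | k <- iota 1 h].
  rewrite map_inj_in_uniq ?iota_uniq // => k l hk hl.
  have H (i j : nat) : i \in iota 1 h -> j \in iota 1 h -> i <= j -> r i = r j -> i = j.
    rewrite !mem_iota => hi hj ij /eqP; rewrite eq_sym /r eqn_mod_dvd ?leq_mul2l ?ij ?orbT //.
    rewrite -mulnBr Euclid_dvdM // (negbTE pa) /=.
    case: (posnP (j - i)) => [|jmi /dvdn_leq]; lia.
  have H2 : r k + r l <> p.
    move=> rr; have : p %| a * (k + l).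
      by rewrite mulnDr /dvdn -modnDm -/(r k) -/(r l) rr modnn.
    rewrite Euclid_dvdM // (negbTE pa) /= => /dvdn_leq.
    by move: hk hl; rewrite !mem_iota; lia.
  have H3 : r k = r l -> k = l.
    move=> e; case: (leqP k l) => [|/ltnW] kl; first exact: H.
    by apply/esym/H.
  rewrite /s; move: H2 (rlt k) (rlt l) H3; case: ifP; case: ifP => ? ? ? ? ? H3 ?;
    by (apply: H3; lia) || lia.
have [] := uniq_min_size us (s2 := iota 1 h) _ _.
- move=> x /mapP[k hk ->]; move: (r0 k hk) (rlt k).
  by rewrite mem_iota /s; case: ifP; lia.
- by rewrite size_map.
by move=> _ e; apply: uniq_perm => //; apply: iota_uniq.
Qed.

Lemma gauss_lemma : legendre p a = ((-1) ^+ (\sum_(1 <= k < h.+1) (h < r k)))%R.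
Proof.
apply: legendre_sign => //.
have hf : ((\prod_(1 <= k < h.+1) k)%:R != 0 :> 'F_p)%R.
  rewrite -[0%R]/(0%:R)%R Fp_nat_eq // mod0n -/(p %| _) big_seq.
  elim/big_rec: _ => [|k x hk IH]; first by rewrite dvdn1; move: (prime_gt1 pp); lia.
  rewrite Euclid_dvdM // negb_or IH andbT; apply/negP => /dvdn_leq.
  by move: hk; rewrite mem_index_iota; lia.
have e1 : ((\prod_(1 <= k < h.+1) (a * k))%:R =
   (-1) ^+ (\sum_(1 <= k < h.+1) (h < r k)) * (\prod_(1 <= k < h.+1) s k)%:R :> 'F_p)%R.
  rewrite expr_sum !natr_prod -big_split /=; apply: eq_bigr => k _.
  have -> : ((a * k)%:R = (r k)%:R :> 'F_p)%R by apply/eqP; rewrite Fp_nat_eq // modn_mod.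
  rewrite /s; case: ifP => _; last by rewrite expr0 mul1r.
  rewrite expr1 mulN1r natrB; last by rewrite ltnW // ltn_mod prime_gt0.
  have -> : (p%:R = 0 :> 'F_p)%R by apply/eqP; rewrite -[0%R]/(0%:R)%R Fp_nat_eq // modnn mod0n.
  by rewrite sub0r opprK.
have e2 : \prod_(1 <= k < h.+1) s k = \prod_(1 <= k < h.+1) k.
  by rewrite /index_iota subn1 /= -[RHS](perm_big _ gauss_residue_perm) /= big_map.
by apply: (mulIf hf); rewrite -[in RHS]e2 -e1 big_split /= prod_nat_const_nat subn1 natrM natrX.
Qed.

(** Modulo 2, with [a] and [p] odd, [k] is the quotient plus [r k], and [s k] is [r k] plus the
    indicator of [h < r k]. The [s k] and the [k] have the same sum, so indicators and quotients
    have the same parity. *)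
Lemma eisenstein_lemma : odd a ->
  legendre p a = ((-1) ^+ (\sum_(1 <= k < h.+1) a * k %/ p))%R.
Proof.
move=> oa; rewrite gauss_lemma; apply/signr_odd_inj.
have os (F : nat -> nat) : odd (\sum_(1 <= k < h.+1) F k) =
    \big[addb/false]_(1 <= k < h.+1) odd (F k).
  by apply: (big_morph odd oddD).
have e : \big[addb/false]_(1 <= k < h.+1) odd (s k) = \big[addb/false]_(1 <= k < h.+1) odd k.
  rewrite -!os; congr odd.
  by rewrite /index_iota subn1 /= -[RHS](perm_big _ gauss_residue_perm) /= big_map.
have addb_false x y : x (+) y = false -> x = y by case: x; case: y.
rewrite !os; apply: addb_false; rewrite -big_split /=.
transitivity (\big[addb/false]_(1 <= k < h.+1) (odd (s k) (+) odd k)).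
  apply: eq_bigr => k _.
  have := congr1 odd (divn_eq (a * k) p); rewrite -/(r k) oddM oa oddD oddM op andbT /=.
  move=> ->; rewrite /s; case: (ltnP h (r k)) => hr.
    rewrite oddB ?op; last by rewrite ltnW // ltn_mod prime_gt0.
    by rewrite /=; case: (odd (r k)); case: (odd (_ %/ _)).
  by rewrite /=; case: (odd (r k)); case: (odd (_ %/ _)).
by rewrite big_split /= e addbb.
Qed.
End GaussLemma.

Lemma divn_count d n m : 0 < d -> n %/ d <= m ->
  n %/ d = \sum_(1 <= l < m.+1) (d * l <= n).
Proof.
move=> d0 nm; under eq_bigr => l _ do rewrite mulnC -leq_divRL //.
move: (n %/ d) nm => c; elim: m c => [|m IH] c; first by rewrite leqn0 => /eqP ->; rewrite big_geq.
rewrite leq_eqVlt => /orP[/eqP ->|cm].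
  rewrite -[LHS]subn0 -[in LHS]subSS -[LHS]muln1 -sum_nat_const_nat.
  by apply: eq_big_nat => i /andP[]; rewrite ltnS => _ ->.
by rewrite big_nat_recr //= -IH // leqNgt cm addn0.
Qed.

(** Eisenstein's count: the two exponents count the lattice points of a [p./2] by [q./2] rectangle
    on either side of its diagonal, which contains none of them. *)
Lemma quadratic_reciprocity p q : prime p -> odd p -> prime q -> odd q -> p != q ->
  legendre p q = ((-1) ^+ (p./2 * q./2) * legendre q p)%R.
Proof.
move=> pp op pq oq pnq.
have npq : ~~ (p %| q) by rewrite dvdn_prime2.
have nqp : ~~ (q %| p) by rewrite dvdn_prime2 // eq_sym.
have p2 : p = p./2.*2.+1 by rewrite -[LHS]odd_double_half op.
have q2 : q = q./2.*2.+1 by rewrite -[LHS]odd_double_half oq.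
rewrite !eisenstein_lemma // -exprD; apply/signr_odd_inj.
set A := \sum_(_ <= _ < _) _; set B := \sum_(_ <= _ < _) _.
suff : A + B = p./2 * q./2 by move=> <-; rewrite !oddD; case: odd; case: odd.
have bnd (x y k : nat) : odd x -> odd y -> k <= x./2 -> (y * k) %/ x <= y./2.
  move=> ox oy kx; have x2 : x = x./2.*2.+1 by rewrite -[LHS]odd_double_half ox.
  have y2 : y = y./2.*2.+1 by rewrite -[LHS]odd_double_half oy.
  by rewrite -ltnS ltn_divLR; [nia|lia].
have -> : A = \sum_(1 <= k < p./2.+1) \sum_(1 <= l < q./2.+1) (p * l <= q * k).
  apply: eq_big_nat => k /andP[_ kp]; rewrite -divn_count ?prime_gt0 //.
  exact: bnd.
have -> : B = \sum_(1 <= k < p./2.+1) \sum_(1 <= l < q./2.+1) (q * k <= p * l).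
  rewrite exchange_big /=.
  apply: eq_big_nat => k /andP[_ kp]; rewrite -divn_count ?prime_gt0 //.
  exact: bnd.
rewrite -big_split /=.
transitivity (\sum_(1 <= k < p./2.+1) q./2); last by rewrite sum_nat_const_nat subn1.
apply: eq_big_nat => k /andP[k0 kp]; rewrite -big_split /=.
transitivity (\sum_(1 <= l < q./2.+1) 1); last by rewrite sum_nat_const_nat subn1 muln1.
apply: eq_big_nat => l /andP[l0 lq].
have : p * l != q * k.
  apply/eqP => e; have : p %| q * k by rewrite -e dvdn_mulr.
  by rewrite Euclid_dvdM // (negbTE npq) /= => /dvdn_leq; lia.
by case: ltngtP.
Qed.

Lemma legendre2 p : prime p -> odd p ->
  legendre p 2 = if (p %% 8 == 1) || (p %% 8 == 7) then 1%R else (-1)%R.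
Proof.
move=> pp op; have p2 : p = p./2.*2.+1 by rewrite -[LHS]odd_double_half op.
have np : ~~ (p %| 2) by apply/negP => /dvdn_leq; move: (prime_gt1 pp); lia.
rewrite gauss_lemma //.
have -> : \sum_(1 <= k < p./2.+1) (p./2 < (2 * k) %% p) = p./2 - p./2./2.
  transitivity (\sum_(1 <= k < p./2.+1) (p./2./2 < k)).
    by apply: eq_big_nat => k /andP[k0 kp]; rewrite modn_small; lia.
  rewrite (@big_cat_nat _ _ _ p./2./2.+1) //=; [|lia].
  rewrite big_nat big1 ?add0n => [|i]; last by lia.
  rewrite big_nat (eq_bigr (fun=> 1)) -?big_nat => [|i]; last by lia.
  by rewrite sum_nat_const_nat muln1 subSS.
rewrite -signr_odd.
have : p %% 8 \in [:: 1; 3; 5; 7] by rewrite !inE; move: op; lia.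
rewrite !inE => /or4P[] /eqP e; rewrite e /=;
  [have -> : odd (p./2 - p./2./2) = false by lia|have -> : odd (p./2 - p./2./2) = true by lia
  |have -> : odd (p./2 - p./2./2) = true by lia|have -> : odd (p./2 - p./2./2) = false by lia] => //.
Qed.
End QuadraticResidues.

(** * Sums of three squares *)

(* The line through the rational point (x, y, z) / w of the sphere and a nearest
   integer point meets the sphere again at a point with a smaller denominator. *)
Lemma davenport_cassels (n : int) (x y z w : int) : 0 < w ->
  x ^+ 2 + y ^+ 2 + z ^+ 2 = n * w ^+ 2 ->
  exists a b c : int, n = a ^+ 2 + b ^+ 2 + c ^+ 2.
Proof.
(* Three squares of at most a quarter each stay below the whole: the new denominator is at most 3/4
   of the old one. *)
have lin (p q r s : int) : 0 < p -> 4 * q <= p -> 4 * r <= p -> 4 * s <= p ->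
    q + r + s < p by lia.
move=> w0; have [k wk] : exists k : nat, (`|w|%N <= k)%N by exists `|w|%N.
elim: k x y z w w0 wk => [|k IH] x y z w w0 wk e; first by lia.
have near (u : int) : exists a : int, 4 * (u - a * w) ^+ 2 <= w ^+ 2.
  (* This rounds [u / w] to a nearest integer. *)
  exists ((2 * u + w) %/ (2 * w))%Z.
  have := divz_eq (2 * u + w) (2 * w).
  have := modz_ge0 (2 * u + w) (_ : 2 * w != 0).
  have := ltz_pmod (2 * u + w) (_ : 0 < 2 * w).
  set a := (_ %/ _)%Z; set r := (_ %% _)%Z => h1 h2 h3.
  have {}h1 : r < 2 * w by apply: h1; lia.
  have {}h2 : 0 <= r by apply: h2; lia.
  have -> : 4 * (u - a * w) ^+ 2 = (2 * (u - a * w)) ^+ 2 by ring.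
  have -> : 2 * (u - a * w) = r - w by lia.
  rewrite -subr_ge0 (_ : _ - _ = r * (2 * w - r)); last by ring.
  by rewrite mulr_ge0 // subr_ge0 ltW.
have [a ha] := near x; have [b hb] := near y; have [c hc] := near z.
set M := a ^+ 2 + b ^+ 2 + c ^+ 2 - n.
set B := 2 * (n * w - (a * x + b * y + c * z)).
(* [M * w + B] becomes the new denominator; it vanishes exactly when the rational point is already
   integral. *)
have ew : w * (M * w + B) = (x - a * w) ^+ 2 + (y - b * w) ^+ 2 + (z - c * w) ^+ 2.
  apply/esym/eqP; rewrite -subr_eq0 (_ : _ - _ = x ^+ 2 + y ^+ 2 + z ^+ 2 - n * w ^+ 2).
    by rewrite e subrr.
  by rewrite /M /B; ring.
have [w' ew'] : exists w', w' = M * w + B by exists (M * w + B).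
rewrite -ew' in ew.
have sq0 : 0 <= (x - a * w) ^+ 2 + (y - b * w) ^+ 2 + (z - c * w) ^+ 2.
  by rewrite !addr_ge0 ?sqr_ge0.
have [w'0|w'0] := eqVneq w' 0.
  exists a, b, c; move: ew; rewrite w'0 mulr0 => ew.
  have [ex ey ez] : [/\ x = a * w, y = b * w & z = c * w].
    have H (p q r : int) : 0 = p ^+ 2 + q ^+ 2 + r ^+ 2 -> [/\ p = 0, q = 0 & r = 0].
      move=> /eqP; rewrite eq_sym paddr_eq0 ?addr_ge0 ?sqr_ge0 //.
      by rewrite paddr_eq0 ?sqr_ge0 // !sqrf_eq0 => /andP[/andP[/eqP -> /eqP ->] /eqP ->].
    by have [h1 h2 h3] := H _ _ _ ew; split; apply/eqP; rewrite -subr_eq0 ?h1 ?h2 ?h3.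
  move: e; rewrite ex ey ez !exprMn -!mulrDl => /mulIf -> //.
  by rewrite expf_neq0 // gt_eqF.
have w'gt : 0 < w'.
  have : 0 <= w * w' by rewrite ew.
  by rewrite pmulr_rge0 // lt_def w'0.
have w'lt : w' < w.
  by rewrite -(ltr_pM2l w0) ew -expr2; apply: lin (exprn_gt0 2 w0) ha hb hc.
apply: (IH (M * x + B * a) (M * y + B * b) (M * z + B * c) w') => //.
  by move: w'lt w'gt w0 wk; clear; lia.
rewrite ew'.
apply/eqP; rewrite -subr_eq0 (_ : _ - _ = M ^+ 2 * (x ^+ 2 + y ^+ 2 + z ^+ 2 - n * w ^+ 2)).
  by rewrite e subrr mulr0.
by rewrite /M /B; ring.
Qed.

Section Pigeonhole.
Local Open Scope nat_scope.

Lemma sqrt_floor n : exists k, k ^ 2 <= n < k.+1 ^ 2.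
Proof.
elim: n => [|n [k hk]]; first by exists 0.
by have [h|h] := ltnP n.+1 (k.+1 ^ 2); [exists k|exists k.+1]; nia.
Qed.

Lemma pigeonhole (T U : finType) (f : T -> U) : #|U| < #|T| ->
  exists x y, x != y /\ f x = f y.
Proof.
move=> c; have : ~~ injectiveb f.
  by apply: contraL c => /injectiveP /leq_card; rewrite -leqNgt.
by move/injectivePn => [x [y xy fxy]]; exists x, y.
Qed.

End Pigeonhole.

(** [(t - 1) * r] represents [- r] modulo [t] without leaving [nat]. *)
Lemma dvdz_sub_cong (t r a b c d : nat) : (0 < t)%N ->
  (a + (t - 1) * r * b == c + (t - 1) * r * d %[mod t])%N ->
  (t %| (a%:Z - c%:Z) - r%:Z * (b%:Z - d%:Z))%Z.
Proof.
move=> t0; rewrite -eqz_nat -!modz_nat eqz_mod_dvd !PoszD !PoszM -subzn // => h.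
have {}h := rpredB h (dvdz_mulr (r%:Z * (b%:Z - d%:Z)) (dvdzz t)).
by move: h; congr (_ %| _)%Z; ring.
Qed.

Lemma sqr_dist_ord (k N : nat) (i j : 'I_k.+1) : (k ^ 2 <= N)%N ->
  (i%:Z - j%:Z) ^+ 2 <= N%:Z.
Proof.
move=> kN; have := ltn_ord i; have := ltn_ord j.
move: (nat_of_ord i) (nat_of_ord j) => a b.
rewrite !ltnS => bk ak; apply: (@le_trans _ _ (k%:Z ^+ 2)); last by lia.
by rewrite -[X in X <= _]real_normK ?num_real // lerXn2r ?nnegrE //; lia.
Qed.

(* The lattice [t | z - r w], [n | z - s v] has index [t n], fewer than the
   number of points of the box of side lengths sqrt (t n), sqrt n, sqrt t. *)
Lemma legendre_lattice (t n r s : nat) : (0 < t)%N -> (0 < n)%N ->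
  exists z v w : int,
  [/\ [|| z != 0, v != 0 | w != 0],
      z ^+ 2 <= (t * n)%N%:Z, v ^+ 2 <= n%:Z, w ^+ 2 <= t%:Z
    & (t %| z - r%:Z * w)%Z /\ (n %| z - s%:Z * v)%Z].
Proof.
move=> t0 n0.
have [Z /andP[hZ hZ']] := sqrt_floor (t * n).
have [V /andP[hV hV']] := sqrt_floor n.
have [W /andP[hW hW']] := sqrt_floor t.
pose f (x : 'I_Z.+1 * 'I_V.+1 * 'I_W.+1) : 'I_t * 'I_n :=
  (Ordinal (ltn_pmod (x.1.1 + (t - 1) * r * x.2)%N t0),
   Ordinal (ltn_pmod (x.1.1 + (n - 1) * s * x.1.2)%N n0)).
have c : (#|{: 'I_t * 'I_n}| < #|{: 'I_Z.+1 * 'I_V.+1 * 'I_W.+1}|)%N.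
  rewrite !card_prod !card_ord -(ltn_exp2r _ _ (isT : (0 < 2)%N)) !expnMn.
  have -> : (t ^ 2 * n ^ 2 = (t * n) * n * t)%N by rewrite !expnS !expn0; lia.
  by apply: ltn_mul => //; apply: ltn_mul.
have [[[z1 v1] w1] [[[z2 v2] w2] [ne [e1 e2]]]] := pigeonhole f c.
exists (z1%:Z - z2%:Z), (v1%:Z - v2%:Z), (w1%:Z - w2%:Z); split.
- apply: contraNT ne; rewrite !negb_or !negbK !subr_eq0 !eqz_nat.
  by rewrite !xpair_eqE -!val_eqE /= => /and3P[-> -> ->].
- exact: sqr_dist_ord.
- exact: sqr_dist_ord.
- exact: sqr_dist_ord.
by split; apply: dvdz_sub_cong; rewrite // ?e1 ?e2.
Qed.

Lemma thue (q s : nat) : (0 < q)%N -> exists x y : int,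
  [/\ (x != 0) || (y != 0), x ^+ 2 <= q%:Z, y ^+ 2 <= q%:Z & (q %| x - s%:Z * y)%Z].
Proof.
move=> q0; have [Q /andP[hQ hQ']] := sqrt_floor q.
pose f (x : 'I_Q.+1 * 'I_Q.+1) : 'I_q :=
  Ordinal (ltn_pmod (x.1 + (q - 1) * s * x.2)%N q0).
have c : (#|{: 'I_q}| < #|{: 'I_Q.+1 * 'I_Q.+1}|)%N.
  by rewrite !card_prod !card_ord mulnn.
have [[x1 y1] [[x2 y2] [ne e]]] := pigeonhole f c.
exists (x1%:Z - x2%:Z), (y1%:Z - y2%:Z); split.
- apply: contraNT ne; rewrite !negb_or !negbK !subr_eq0 !eqz_nat.
  by rewrite !xpair_eqE -!val_eqE /= => /andP[-> ->].
- exact: sqr_dist_ord.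
- exact: sqr_dist_ord.
by apply: dvdz_sub_cong => //; apply/eqP; case: e.
Qed.

Lemma sqr_neq_prime_mul (q k : nat) (x : int) : prime q -> ~~ (q %| k)%N ->
  x ^+ 2 != (q * k)%N%:Z.
Proof.
move=> pq qk; apply: contraNneq qk => e.
have {}e : (`|x| ^ 2 = q * k)%N.
  by apply/eqP; rewrite -eqz_nat -e; lia.
have : (q %| `|x| ^ 2)%N by rewrite e dvdn_mulr.
rewrite Euclid_dvdX // => /andP[/dvdnP[j ej] _].
by move: e; rewrite ej => e; apply/dvdnP; exists (j * j)%N; move: (prime_gt0 pq); nia.
Qed.

Lemma sum_two_squares_prime (q s : nat) : prime q -> (q %| s ^ 2 + 1)%N ->
  exists x y : int, q%:Z = x ^+ 2 + y ^+ 2.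
Proof.
move=> pq qs; have [x [y [ne hx hy d]]] := thue s (prime_gt0 pq).
exists x, y.
have np u : u ^+ 2 != q%:Z by have := sqr_neq_prime_mul u pq (_ : ~~ (q %| 1)%N); rewrite muln1 dvdn1; apply; move: (prime_gt1 pq); lia.
have : (q %| x ^+ 2 + y ^+ 2)%Z.
  have -> : x ^+ 2 + y ^+ 2 = (x - s%:Z * y) * (x + s%:Z * y) + (s ^ 2 + 1)%N%:Z * y ^+ 2.
    by rewrite (_ : (s ^ 2 + 1)%N%:Z = s%:Z * s%:Z + 1); [ring|lia].
  by rewrite rpredD // dvdz_mulr // dvdzE.
case/dvdzP => k ek.
have h0 : 0 < x ^+ 2 + y ^+ 2.
  by rewrite lt_def addr_ge0 ?sqr_ge0 // paddr_eq0 ?sqr_ge0 // !sqrf_eq0 negb_and ne.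
have h1 : x ^+ 2 + y ^+ 2 < 2 * q%:Z.
  by rewrite mulr_natl mulr2n ltrD // lt_neqAle np.
rewrite ek in h0 h1 *.
have q0 := prime_gt0 pq.
by have -> : k = 1 by [nia]; rewrite mul1r.
Qed.

(** For the small lattice vector, [F] is a multiple of [t * n] lying strictly between [- t n] and
    [2 t n]; the non-square hypotheses make these bounds strict. So [F] is 0 or [t * n]. *)
Lemma legendre_equation (t n r s : nat) : (0 < t)%N -> (0 < n)%N -> coprime t n ->
  (forall x : int, x ^+ 2 != t%:Z) -> (forall x : int, x ^+ 2 != (t * n)%N%:Z) ->
  (r ^ 2 = n %[mod t])%N -> (n %| s ^ 2 + t)%N ->
  exists z v w : int, w != 0 /\ z ^+ 2 + t%:Z * v ^+ 2 = n%:Z * w ^+ 2.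
Proof.
move=> t0 n0 tn nst nstn /eqP rn sn.
have [z [v [w [ne hz hv hw [dt dn]]]]] := legendre_lattice r s t0 n0.
pose F := z ^+ 2 + t%:Z * v ^+ 2 - n%:Z * w ^+ 2.
have sqE (k : nat) : (k ^ 2)%N%:Z = k%:Z * k%:Z by lia.
have dF : ((t * n)%N %| F)%Z.
  have cop : coprimez t n by [].
  rewrite PoszM Gauss_dvdz //; apply/andP; split.
    have -> : F = (z - r%:Z * w) * (z + r%:Z * w) + ((r ^ 2)%N%:Z - n%:Z) * w ^+ 2 + t%:Z * v ^+ 2.
      by rewrite /F sqE; ring.
    rewrite rpredD ?rpredD ?dvdz_mulr ?dvdzz //.
    by rewrite -eqz_mod_dvd !modz_nat eqz_nat.
  have -> : F = (z - s%:Z * v) * (z + s%:Z * v) + (s ^ 2 + t)%N%:Z * v ^+ 2 - n%:Z * w ^+ 2.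
    by rewrite PoszD /F sqE; ring.
  by rewrite rpredB ?rpredD ?dvdz_mulr ?dvdzz // dvdzE.
have [F0|Ftn] : F = 0 \/ F = (t * n)%N%:Z.
  case/dvdzP: dF => k ek.
  have h1 : z ^+ 2 < (t * n)%N%:Z by rewrite lt_neqAle nstn.
  have h2 : w ^+ 2 < t%:Z by rewrite lt_neqAle nst.
  have h3 : t%:Z * v ^+ 2 <= (t * n)%N%:Z by rewrite PoszM ler_pM2l.
  have h4 : n%:Z * w ^+ 2 < (t * n)%N%:Z by rewrite PoszM mulrC ltr_pM2r.
  have h5 : 0 <= t%:Z * v ^+ 2 by rewrite mulr_ge0 ?sqr_ge0.
  have h6 : 0 <= n%:Z * w ^+ 2 by rewrite mulr_ge0 ?sqr_ge0.
  have h7 := sqr_ge0 z.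
  have tn0 : (0 < t * n)%N by rewrite muln_gt0 t0.
  move: h1 h3 h4 h5 h6 h7 tn0; rewrite ek; move: ek; rewrite /F.
  move: (z ^+ 2) (t%:Z * v ^+ 2) (n%:Z * w ^+ 2) (t * n)%N => a b c d; clear.
  move=> e ha hb hc hb0 hc0 ha0 hd.
  have : k = 0 \/ k = 1 by nia.
  by case=> ->; [left; rewrite mul0r|right; rewrite mul1r].
- exists z, v, w; split; last by apply/eqP; rewrite -subr_eq0 -/F F0.
  apply/negP => /eqP w0; move: ne F0; rewrite /F w0 eqxx orbF expr0n mulr0 subr0 => ne /eqP.
  rewrite paddr_eq0 ?sqr_ge0 //; last by rewrite mulr_ge0 ?sqr_ge0.
  rewrite sqrf_eq0 mulf_eq0 sqrf_eq0 => /andP[/eqP z0].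
  by move: ne; rewrite z0 eqxx /= => /negbTE ->; rewrite orbF eqz_nat; lia.
(* Here [z^2 + t v^2 = n (w^2 + t)]: multiply by [w^2 + t = w^2 + t 1^2] and use
   the composition law of the form [x^2 + t y^2]. *)
exists (z * w - t%:Z * v), (z + v * w), (w ^+ 2 + t%:Z); split.
  by rewrite gt_eqF // ltr_wpDl ?sqr_ge0.
have e : z ^+ 2 + t%:Z * v ^+ 2 = n%:Z * (w ^+ 2 + t%:Z).
  by apply/eqP; rewrite -subr_eq0 mulrDr opprD addrA -/F Ftn PoszM mulrC subrr.
rewrite -[RHS]/(n%:Z * ((w ^+ 2 + t%:Z) * (w ^+ 2 + t%:Z))) mulrA -e; ring.
Qed.

Section SquarefreeResidues.
Local Open Scope nat_scope.

Lemma legendre_completely_mult (q n : nat) (f : nat -> int) : prime q -> odd q ->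
  odd n -> f 1 = 1%R ->
  (forall a b, odd a -> odd b -> f (a * b) = (f a * f b)%R) ->
  (forall p, prime p -> p %| n -> legendre q p = f p) -> legendre q n = f n.
Proof.
move=> pq oq + f1 fM; elim/ltn_ind: n => n IH on hp.
have [n1|n1] := leqP n 1.
  have -> : n = 1 by case: n n1 on {IH hp} => [|[]].
  rewrite f1; apply: (@legendre_sq q 1 1) => //; first exact: prime_gt0.
  by rewrite dvdn1; move: (prime_gt1 pq); lia.
have pp := pdiv_prime n1; have /dvdnP[k ek] := pdiv_dvd n.
move: on hp; rewrite [in odd n]ek oddM => /andP[ok op] hp.
rewrite ek mulnC legendreM // fM // hp ?pdiv_dvd // IH //.
  rewrite [n in _ < n]ek -[k in k < _]muln1 ltn_mul2l prime_gt1 // andbT.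
  by case: k ok {ek}.
by move=> p pp' pk; apply: hp => //; rewrite ek dvdn_mulr.
Qed.

(** Squarefreeness makes [n] a product of distinct primes, so the roots modulo its prime factors are
    glued by the Chinese remainder theorem, with no lifting to prime powers. *)
Lemma squarefree_oppr_square (n t : nat) : 0 < n ->
  (forall p, prime p -> ~~ (p ^ 2 %| n)) ->
  (forall p, prime p -> p %| n -> exists s, p %| s ^ 2 + t) ->
  exists s, n %| s ^ 2 + t.
Proof.
elim/ltn_ind: n => n IH n0 sf hp.
have [n1|n1] := leqP n 1; first by exists 0; have -> : n = 1 by lia.
have pp := pdiv_prime n1; have /dvdnP[k ek] := pdiv_dvd n.
have k0 : 0 < k by move: n0; rewrite ek muln_gt0 => /andP[].
have cop : coprime (pdiv n) k.
  rewrite prime_coprime //; apply/negP => /dvdnP[j ej].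
  by move/negP: (sf _ pp); apply; rewrite [n in _ %| n]ek ej -mulnA dvdn_mull.
have [||||s hs] := IH k.
- by rewrite [n in _ < n]ek -[k in k < _]muln1 ltn_mul2l k0 prime_gt1.
- by [].
- by move=> p pp'; apply: contra (sf p pp'); rewrite ek => /dvdn_mulr.
- by move=> p pp' pk; apply: hp => //; rewrite ek dvdn_mulr.
have [s' hs'] := hp _ pp (pdiv_dvd n).
exists (chinese (pdiv n) k s' s).
rewrite [X in X %| _]ek mulnC Gauss_dvd //; apply/andP; split.
  by rewrite /dvdn -modnDml -modnXm (chinese_modl cop) modnXm modnDml.
by rewrite /dvdn -modnDml -modnXm (chinese_modr cop) modnXm modnDml.
Qed.
End SquarefreeResidues.

Definition sum3squares (n : nat) := exists x y z : int, n%:Z = x ^+ 2 + y ^+ 2 + z ^+ 2.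

Lemma sum3squares_of_equation (t n r s : nat) (x y : int) : (0 < t)%N -> (0 < n)%N -> coprime t n ->
  (forall x : int, x ^+ 2 != t%:Z) -> (forall x : int, x ^+ 2 != (t * n)%N%:Z) ->
  (r ^ 2 = n %[mod t])%N -> (n %| s ^ 2 + t)%N -> t%:Z = x ^+ 2 + y ^+ 2 ->
  sum3squares n.
Proof.
move=> t0 n0 tn nst nstn rn sn txy.
have [z [v [w [w0 e]]]] := legendre_equation t0 n0 tn nst nstn rn sn.
have e2 : z ^+ 2 + (v * x) ^+ 2 + (v * y) ^+ 2 = n%:Z * w ^+ 2 by rewrite -e txy; ring.
have [wp|] := ltP 0 w; first exact: davenport_cassels wp e2.
rewrite le_eqVlt (negbTE w0) /= => wn.
by apply: (@davenport_cassels _ z (v * x) (v * y) (- w)); rewrite ?oppr_gt0 // sqrrN.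
Qed.

(** * Choice of the auxiliary prime *)

Section ThreeSquareTheorem.
Local Open Scope nat_scope.

(** [chi4] and [chi8] are the symbols (-1/a) and (2/a) for odd [a]. Both are tabulated modulo 8, so
    multiplicativity is a single finite check. *)
Definition chi4 (a : nat) : int := nth 0%R [:: 0; 1; 0; -1; 0; 1; 0; -1]%R (a %% 8).
Definition chi8 (a : nat) : int := nth 0%R [:: 0; 1; 0; -1; 0; -1; 0; 1]%R (a %% 8).

Lemma mod8_table_mult (t : seq int) :
  all (fun i => all (fun j => nth 0%R t ((i * j) %% 8) == (nth 0%R t i * nth 0%R t j)%R) (iota 0 8)) (iota 0 8) ->
  forall a b, nth 0%R t ((a * b) %% 8) = (nth 0%R t (a %% 8) * nth 0%R t (b %% 8))%R.
Proof.
move=> h a b; rewrite -modnMm.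
have := allP h (a %% 8); rewrite mem_iota ltn_mod => /(_ isT) /allP /(_ (b %% 8)).
by rewrite mem_iota ltn_mod => /(_ isT) /eqP.
Qed.

Lemma chi4M a b : chi4 (a * b) = (chi4 a * chi4 b)%R.
Proof. exact: mod8_table_mult. Qed.

Lemma chi8M a b : chi8 (a * b) = (chi8 a * chi8 b)%R.
Proof. exact: mod8_table_mult. Qed.

Lemma chi4_sign p : odd p -> ((-1) ^+ p./2)%R = chi4 p.
Proof.
move=> op; rewrite /chi4 -signr_odd.
have : p %% 8 \in [:: 1; 3; 5; 7] by rewrite !inE; move: op; lia.
rewrite !inE => /or4P[] /eqP e; rewrite e /=.
- by have -> : odd p./2 = false by lia.
- by have -> : odd p./2 = true by lia.
- by have -> : odd p./2 = false by lia.
- by have -> : odd p./2 = true by lia.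
Qed.

Lemma legendre2_chi8 p : prime p -> odd p -> legendre p 2 = chi8 p.
Proof.
move=> pp op; rewrite legendre2 // /chi8.
have : p %% 8 \in [:: 1; 3; 5; 7] by rewrite !inE; move: op; lia.
by rewrite !inE => /or4P[] /eqP ->.
Qed.

Lemma mod8_pm1 (a m : nat) : coprime a (8 * m) -> a %% 8 \in [:: 1; 3; 5; 7].
Proof.
rewrite coprimeMr coprime_sym (@coprime_pexpl 3 2) // coprime2n => /andP[oa _].
by rewrite !inE; move: oa; lia.
Qed.

(** The pair of values of [chi4] and [chi8] determines an odd class modulo 8, so the congruence on
    [q] is also a condition on real characters. *)
Lemma exists_prime_legendre (R : realType) (n e v : nat) : odd n -> odd e -> e < 8 -> coprime v n ->
  exists q, [/\ prime q, q %% 8 = e, coprime q n &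
    forall p, prime p -> p %| n -> legendre p q = legendre p v].
Proof.
move=> on oe e8 vn.
have c8 k : odd k -> coprime 8 k by move=> ok; rewrite (@coprime_pexpl 3 2) // coprime2n.
pose u := chinese 8 n e v.
have u8 : u %% 8 = e by rewrite chinese_modl ?c8 // modn_small.
have un : u = v %[mod n] by rewrite chinese_modr ?c8.
have cu : coprime u (8 * n).
  rewrite coprimeMr -coprime_modl u8 coprime_sym c8 //=.
  by rewrite -coprime_modl un coprime_modl.
(* The indices 0 and 1, which are not primes, are free to name [chi4] and [chi8]. *)
pose chi i := if i == 0 then chi4 else if i == 1 then chi8 else legendre i.
have n0 : 0 < n by case: n on {vn u u8 un cu}.
have ch : {in 0 :: 1 :: primes n, forall i, real_character (8 * n) (chi i)}.
  move=> i; rewrite !inE => /or3P[/eqP->|/eqP->|]; rewrite /chi /=.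
  - split; [exact: chi4M|by move=> a; rewrite /chi4 addnC mulnC modnMDl|].
    move=> a /mod8_pm1; rewrite /chi4 !inE => /or4P[] /eqP ->; by [left|right].
  - split; [exact: chi8M|by move=> a; rewrite /chi8 addnC mulnC modnMDl|].
    move=> a /mod8_pm1; rewrite /chi8 !inE => /or4P[] /eqP ->; by [left|right].
  rewrite mem_primes => /and3P[pi _ di].
  have oi : odd i by apply: dvdn_odd di on.
  have -> : (i == 0) = false by case: i pi {di oi}.
  have -> : (i == 1) = false by case: i pi {di oi} => [|[]].
  split.
  - by move=> a b; apply: legendreM.
  - move=> a; rewrite -legendre_mod; case/dvdnP: di => k ->.
    by rewrite addnC mulnA modnMDl legendre_mod.
  move=> a ca; apply: legendre_pm1; rewrite -prime_coprime // coprime_sym.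
  exact: coprime_dvdr (dvdn_mull 8 di) ca.
have m0 : 0 < 8 * n by rewrite muln_gt0.
have [q [pq cq hq]] := exists_prime_real_characters R m0 cu ch.
have := mod8_pm1 cq; have := mod8_pm1 cu.
have h4 : chi4 q = chi4 u by apply: (hq 0); rewrite inE.
have h8 : chi8 q = chi8 u by apply: (hq 1); rewrite !inE.
move=> hu hq8; exists q; split => //.
- rewrite -u8; move: hu hq8 h4 h8; rewrite /chi4 /chi8 !inE.
  by move=> /or4P[] /eqP -> /or4P[] /eqP -> /eqP + /eqP.
- by move: cq; rewrite coprimeMr => /andP[].
move=> p pp pn.
have := hq p; rewrite !inE mem_primes pp n0 pn !orbT /chi => /(_ isT).
have -> : (p == 0) = false by case: p pp {pn}.
have -> : (p == 1) = false by case: p pp {pn} => [|[]].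
move=> ->; rewrite -legendre_mod -[RHS]legendre_mod; congr legendre.
by case/dvdnP: pn un => k -> un; rewrite -(modn_dvdm u (dvdn_mull k (dvdnn p))) un modn_dvdm // dvdn_mull.
Qed.

Lemma legendre_pred_dvd p n : prime p -> odd p -> 0 < n -> p %| n ->
  legendre p n.-1 = chi4 p.
Proof.
move=> pp op n0 /dvdnP[k ek]; rewrite -chi4_sign // -legendre_pred //.
rewrite -legendre_mod; congr legendre.
have k0 : 0 < k by move: n0; rewrite ek; case: k {ek}.
have -> : n.-1 = k.-1 * p + p.-1 by rewrite ek; move: (prime_gt0 pp); nia.
by rewrite modnMDl modn_small // prednK ?prime_gt0.
Qed.

(* [c * q] is a sum of two squares, and the residue conditions make it a value of
   [n w^2 - z^2] over the rationals. *)
Lemma sum3squares_of_prime (n q c v: nat) : 0 < n -> prime q -> q %% 4 = 1 ->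
  (c = 1 \/ c = 2) -> coprime (c * q) n ->
  (forall p, prime p -> ~~ (p ^ 2 %| n)) ->
  (forall p, prime p -> odd p -> p %| n -> legendre p (c * q) = chi4 p) ->
  legendre q n = 1%R -> sum3squares n.
Proof.
move=> n0 pq q4 c12 cop sf hp qn.
have [oq oq2] : odd q /\ odd q./2 = false by move: q4; clear; lia.
have q0 := prime_gt0 pq.
have c0 : 0 < c by case: c12 => ->.
have [s hs] : exists s, n %| s ^ 2 + c * q.
  apply: squarefree_oppr_square => // p pp pn.
  have [p2|p2] := eqVneq p 2; first by exists (c * q); rewrite p2 dvdn2 oddD oddX; case: odd.
  have op : odd p by case/even_prime: pp p2 => // ->.
  have c1 : legendre p (c * q * p.-1) = 1%R.
    rewrite legendreM // hp // legendre_pred // -chi4_sign //.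
    by rewrite -signr_odd; case: odd.
  have [x hx] := legendre_eq1 c1; exists x.
  rewrite /dvdn -modnDml hx modnDml -mulnSr prednK ?prime_gt0 //.
  by rewrite modnMl.
have [r0 hr0] := legendre_eq1 qn.
have [r hr] : exists r, r ^ 2 = n %[mod c * q].
  case: c12 => ec; rewrite ec; first by exists r0; rewrite mul1n.
  have on : odd n by move: cop; rewrite ec coprimeMl coprime2n => /andP[].
  have co : coprime 2 q by rewrite coprime2n.
  (* Adding the odd number [q] when [r0] is even makes the root odd, hence also a root modulo 2, and
     does not change it modulo [q]. *)
  exists (r0 + q * ~~ odd r0); apply/eqP; rewrite chinese_remainder //; apply/andP; split.
    by rewrite !modn2 oddX oddD oddM oq on; case: (odd r0).
  by rewrite -modnXm mulnC addnC modnMDl modnXm; apply/eqP.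
have qs1 : exists s, q %| s ^ 2 + 1.
  have : legendre q q.-1 = 1%R by rewrite legendre_pred // -signr_odd oq2.
  move/legendre_eq1 => [x hx]; exists x.
  by rewrite /dvdn -modnDml hx modnDml addn1 prednK // modnn.
have [s1 /(sum_two_squares_prime pq)[x [y exy]]] := qs1.
have qnn : ~~ (q %| n) by move: cop; rewrite coprimeMl => /andP[_]; rewrite prime_coprime.
have qc : ~~ (q %| c).
  by apply/negP => /dvdn_leq; move: (prime_gt1 pq) q4; case: c12 => ->; clear; lia.
have qcn : ~~ (q %| c * n) by rewrite Euclid_dvdM // negb_or qc.
have [x' [y' exy']] : exists x' y' : int, (c * q)%:Z = (x' ^+ 2 + y' ^+ 2)%R.
  case: c12 => ->; first by exists x, y; rewrite mul1n.
  by exists (x + y)%R, (x - y)%R; rewrite PoszM exy; ring.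
apply: (sum3squares_of_equation _ n0 cop _ _ hr hs exy').
- by rewrite muln_gt0 c0.
- by move=> z; rewrite mulnC; apply: sqr_neq_prime_mul.
- by move=> z; rewrite [c * q]mulnC -mulnA; apply: sqr_neq_prime_mul.
Qed.

Lemma legendre_q_odd_part q n (f : nat -> int) : prime q -> q %% 4 = 1 -> odd n -> coprime q n ->
  f 1 = 1%R -> (forall a b, f (a * b) = (f a * f b)%R) ->
  (forall p, prime p -> odd p -> p %| n -> legendre p q = f p) -> legendre q n = f n.
Proof.
move=> pq q4 on qn f1 fM hp.
have [oq oq2] : odd q /\ odd q./2 = false by move: q4; clear; lia.
apply: legendre_completely_mult => // p pp pn.
have op : odd p by apply: dvdn_odd pn on.
rewrite quadratic_reciprocity //; last first.
  by apply: contraTneq qn => ->; rewrite prime_coprime // pn.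
by rewrite -signr_odd oddM oq2 /= mul1r hp.
Qed.

(* The prime [q] is chosen with [- c q] a square modulo every odd prime factor of
   [n]; then by reciprocity [legendre q n] is [chi4 n] (times [chi8 q] if [n] is
   even) for [c = 1], and [chi4 n * chi8 n] for [c = 2]. *)
Lemma sum3squares_squarefree (R : realType) n : (forall p, prime p -> ~~ (p ^ 2 %| n)) ->
  [|| n %% 4 == 1, n %% 4 == 2 | n %% 8 == 3] -> sum3squares n.
Proof.
move=> sf hn.
have n0 : 0 < n by move: hn; clear; lia.
have pred_coprime k : 0 < k -> coprime k.-1 k.
  by case: k => // k _; rewrite coprime_sym coprimeSn.
have inv p : odd p -> (chi4 p * chi4 p)%R = 1%R.
  by move=> op; rewrite -chi4_sign // -signr_odd; case: odd.
case/or3P: hn => /eqP hn.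
- have on : odd n by move: hn; clear; lia.
  have [q [pq q1 qn hq]] := @exists_prime_legendre R n 1 n.-1 on isT isT (pred_coprime _ n0).
  have q4 : q %% 4 = 1 by move: q1; clear; lia.
  have hq' p : prime p -> odd p -> p %| n -> legendre p q = chi4 p.
    by move=> pp op pn; rewrite hq // legendre_pred_dvd.
  apply: (@sum3squares_of_prime n q 1 1) => //; rewrite ?mul1n //; first by left.
  rewrite (legendre_q_odd_part pq q4 on qn (f := chi4)) //; last exact: chi4M.
  rewrite -chi4_sign // -signr_odd; have -> : odd n./2 = false by move: hn; clear; lia.
  by [].
- have [n' [en on]] : exists n', n = 2 * n' /\ odd n' by exists n./2; move: hn; clear; lia.
  have n'0 : 0 < n' by move: on; clear; lia.
  (* [q = 5] modulo 8 makes the symbol of 2 equal to -1, which compensates for [chi4 n' = -1]. *)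
  pose e := if chi4 n' == 1%R then 1 else 5.
  have [q [pq qe qn hq]] := @exists_prime_legendre R n' e n'.-1 on
    (ltac:(by rewrite /e; case: ifP)) (ltac:(by rewrite /e; case: ifP)) (pred_coprime _ n'0).
  have q4 : q %% 4 = 1 by move: qe; rewrite /e; case: ifP => _; clear; lia.
  have oq : odd q by move: q4; clear; lia.
  have hq' p : prime p -> odd p -> p %| n' -> legendre p q = chi4 p.
    by move=> pp op pn; rewrite hq // legendre_pred_dvd.
  apply: (@sum3squares_of_prime n q 1 1) => //; rewrite ?mul1n //; first by left.
  + by rewrite en coprimeMr coprimen2 oq.
  + move=> p pp op pn; apply: hq' => //; move: pn; rewrite en Euclid_dvdM // => /orP[|//].
    by rewrite dvdn_prime2 // => /eqP p2; rewrite p2 in op.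
  rewrite en legendreM // (legendre_q_odd_part pq q4 on qn (f := chi4)) //; last exact: chi4M.
  rewrite legendre2_chi8 // {1}/chi8 qe /e; case: ifP => [/eqP -> //|].
  by rewrite -chi4_sign // -signr_odd; case: odd.
have on : odd n by move: hn; clear; lia.
(* As [2 * n./2 = n - 1], [n./2] represents [-1/2] modulo [n]; its symbol at [p] is that of -2, so
   [2 * q] gets the symbol of -1. *)
have cn : coprime n./2 n.
  have {2}-> : n = n./2 + n./2.+1 by move: on; clear; lia.
  by rewrite /coprime gcdnDl -/(coprime _ _) coprimenS.
have [q [pq q1 qn hq]] := @exists_prime_legendre R n 1 n./2 on isT isT cn.
have q4 : q %% 4 = 1 by move: q1; clear; lia.
have oq : odd q by move: q4; clear; lia.
have hq' p : prime p -> odd p -> p %| n -> legendre p q = (chi4 p * chi8 p)%R.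
  move=> pp op pn; rewrite hq //.
  have <- : legendre p (2 * n./2) = chi4 p.
    by rewrite -(legendre_pred_dvd pp op n0 pn); congr legendre; move: on; clear; lia.
  rewrite legendreM // legendre2_chi8 // mulrAC.
  have -> : (chi8 p * chi8 p)%R = 1%R; last by rewrite mul1r.
  rewrite -legendre2_chi8 //; have [|->|->] := @legendre_pm1 p 2 => //.
  by apply/negP => /dvdn_leq; move: (prime_gt1 pp) op; clear; lia.
apply: (@sum3squares_of_prime n q 2 1) => //; first by right.
- by rewrite coprimeMl coprime2n on.
- move=> p pp op pn; rewrite legendreM // hq' // legendre2_chi8 // mulrCA.
  have -> : (chi8 p * chi8 p)%R = 1%R; last by rewrite mulr1.
  rewrite -legendre2_chi8 //; have [|->|->] := @legendre_pm1 p 2 => //.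
  by apply/negP => /dvdn_leq; move: (prime_gt1 pp) op; clear; lia.
rewrite (legendre_q_odd_part pq q4 on qn (f := fun p => chi4 p * chi8 p)%R) //.
  by rewrite /chi4 /chi8 hn.
by move=> a b; rewrite chi4M chi8M mulrACA.
Qed.

(** A square factor [p ^ 2] is divided out. Here [p] is odd because 4 does not divide [n], so
    [p ^ 2] is 1 modulo 8 and the residue condition persists. *)
Lemma three_squares (R : realType) n :
  [|| n %% 4 == 1, n %% 4 == 2 | n %% 8 == 3] -> sum3squares n.
Proof.
elim/ltn_ind: n => n IH hn.
have [sf|] := pselect (forall p, prime p -> ~~ (p ^ 2 %| n)); first exact: sum3squares_squarefree.
move/existsNP => [p /not_implyP[pp /negP/negPn/dvdnP[k ek]]].
have k0 : 0 < k by case: k ek hn => // ->.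
have op : odd p.
  case/even_prime: pp ek => // -> ek; move: hn ek; clear; lia.
have [||x [y [z e]]] := IH k.
- by rewrite ek -[k in k < _]muln1 ltn_mul2l k0 (@ltn_exp2r 1 p 2) // prime_gt1.
- have p8 : p ^ 2 %% 8 = 1.
    rewrite -modnXm; have : p %% 8 \in [:: 1; 3; 5; 7] by rewrite !inE; move: op; clear; lia.
    by rewrite !inE => /or4P[] /eqP ->.
  have : n %% 8 = k %% 8 by rewrite ek -modnMmr p8 muln1.
  by move: hn; clear; lia.
exists (x * p%:Z)%R, (y * p%:Z)%R, (z * p%:Z)%R; rewrite ek PoszM e.
have -> : (p ^ 2)%:Z = (p%:Z * p%:Z)%R by clear; lia.
by ring.
Qed.
End ThreeSquareTheorem.

(** * Binary partitions modulo 32 *)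

Section BinaryPartitionRecurrence.
Local Open Scope nat_scope.

(** Multiplicities as a function on all of [nat]: partitions of different numbers, whose finite
    function types differ, become comparable. *)
Definition binary_multiplicities (n : nat) (w : nat -> nat) :=
  [/\ w 0 = 0, forall i, 0 < w i -> is_pow2 i, forall i, n < i -> w i = 0
    & \sum_(0 <= i < n.+1) w i * i = n].

Definition ffun_ext (n : nat) (mu : {ffun 'I_n.+1 -> 'I_n.+1}) (i : nat) : nat :=
  if i <= n then nat_of_ord (mu (inord i)) else 0.

Definition ffun_mk (n : nat) (w : nat -> nat) : {ffun 'I_n.+1 -> 'I_n.+1} :=
  [ffun i : 'I_n.+1 => inord (w i)].

Local Notation bparts n :=
  [set mu : {ffun 'I_n.+1 -> 'I_n.+1} | is_partition mu && parts_pow2 mu]%SET.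

Lemma is_pow2P k : reflect (exists j, k = 2 ^ j) (is_pow2 k).
Proof.
apply: (iffP existsP) => [[j /eqP ->]|[j ->]]; first by exists j.
have hj : j < (2 ^ j).+1 by rewrite ltnS ltnW // ltn_expl.
by exists (Ordinal hj) => /=.
Qed.

Lemma is_pow2_odd k : is_pow2 k -> odd k -> k = 1.
Proof. by move=> /is_pow2P[j ->]; rewrite oddX orbF => /eqP ->. Qed.

Lemma is_pow2_double k : is_pow2 k.*2 = is_pow2 k.
Proof.
apply/is_pow2P/is_pow2P => -[j e]; last by exists j.+1; rewrite e expnS mul2n.
case: j e => [|j] e; first by move: (congr1 odd e); rewrite odd_double.
by exists j; move: e; rewrite expnS mul2n => /double_inj.
Qed.

Lemma ffun_ext_ord n (mu : {ffun 'I_n.+1 -> 'I_n.+1}) (i : 'I_n.+1) : ffun_ext mu i = mu i.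
Proof. by rewrite /ffun_ext -ltnS ltn_ord inord_val. Qed.

Lemma ffun_ext_inj n (mu nu : {ffun 'I_n.+1 -> 'I_n.+1}) :
  ffun_ext mu =1 ffun_ext nu -> mu = nu.
Proof. by move=> h; apply/ffunP => i; apply/val_inj; rewrite /= -!ffun_ext_ord. Qed.

Lemma bpartsP n (mu : {ffun 'I_n.+1 -> 'I_n.+1}) :
  (mu \in bparts n) <-> binary_multiplicities n (ffun_ext mu).
Proof.
rewrite inE; split.
  move=> /andP[/andP[/eqP m0 /eqP ms] /forallP mp]; split.
  - by rewrite -[0]/(val (@ord0 n)) ffun_ext_ord m0.
  - move=> i; rewrite /ffun_ext; case: ifP => // hi h.
    by have := mp (inord i); rewrite h /= inordK.
  - by move=> i; rewrite /ffun_ext ltnNge => /negbTE ->.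
  by rewrite big_mkord -[RHS]ms; apply: eq_bigr => i _; rewrite ffun_ext_ord.
case=> w0 wp _ ws; apply/andP; split.
  apply/andP; split.
    by apply/eqP/val_inj => /=; rewrite -ffun_ext_ord.
  by apply/eqP; rewrite -[RHS]ws big_mkord; apply: eq_bigr => i _; rewrite ffun_ext_ord.
apply/forallP => i; apply/implyP => h; apply: wp.
by rewrite ffun_ext_ord.
Qed.

Lemma binary_multiplicities_le n w i : binary_multiplicities n w -> w i <= n.
Proof.
case=> w0 wp wn ws; case: i => [|i]; first by rewrite w0.
have [hi|/wn -> //] := leqP i.+1 n.
rewrite -[X in _ <= X]ws (bigD1_seq i.+1) ?iota_uniq ?mem_index_iota //=.
by apply: leq_trans (leq_addr _ _); rewrite leq_pmulr.
Qed.

Lemma ffun_mkK n w : binary_multiplicities n w -> ffun_ext (ffun_mk n w) =1 w.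
Proof.
move=> hw i; rewrite /ffun_ext; case: leqP => hi; last by case: hw => _ _ /(_ _ hi) ->.
by rewrite ffunE !inordK // ltnS; apply: binary_multiplicities_le hw.
Qed.

Lemma sum_even_odd (K : nat) (F : nat -> nat) :
  \sum_(0 <= i < K.*2) F i = \sum_(0 <= j < K) F j.*2 + \sum_(0 <= j < K) F j.*2.+1.
Proof.
elim: K => [|K IH]; first by rewrite !big_geq.
by rewrite doubleS !big_nat_recr //= IH; lia.
Qed.

Lemma sum_widen (m n : nat) (F : nat -> nat) : m <= n -> (forall i, m <= i -> F i = 0) ->
  \sum_(0 <= i < m) F i = \sum_(0 <= i < n) F i.
Proof.
move=> mn h; rewrite [RHS](@big_cat_nat _ _ _ m) //= [X in _ + X]big1_seq ?addn0 // => i.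
by rewrite mem_index_iota => /andP[_ /andP[/h]].
Qed.

Lemma pow2_support_sum n w : (forall i, 0 < w i -> is_pow2 i) -> (forall i, n < i -> w i = 0) ->
  \sum_(0 <= i < n.+1) w i * i = w 1 + (\sum_(0 <= j < n.+1) w j.*2 * j).*2.
Proof.
move=> wp wn; rewrite (@sum_widen n.+1 n.+1.*2); first last.
- by move=> i /wn ->.
- by rewrite -addnn leq_addr.
rewrite sum_even_odd addnC; congr (_ + _).
  rewrite big_nat_recl //= big1_seq ?addn0 ?muln1 // => j _.
  case: (posnP (w j.+1.*2.+1)) => [-> //|/wp /is_pow2_odd].
  by rewrite /= odd_double => /(_ isT).
rewrite -muln2 big_distrl /=; apply: eq_bigr => j _.
by rewrite -mulnA muln2.
Qed.

Definition halve_parts (w : nat -> nat) (j : nat) := w j.*2.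
Definition double_parts (n k : nat) (w : nat -> nat) (i : nat) :=
  if i == 1 then n - k.*2 else if odd i then 0 else w i./2.

Lemma halve_partsP n w : binary_multiplicities n w ->
  exists2 k, k.*2 <= n & w 1 = n - k.*2 /\ binary_multiplicities k (halve_parts w).
Proof.
case=> w0 wp wn ws; have := pow2_support_sum wp wn; rewrite ws.
set k := \sum_(_ <= _ < _) _ => e; exists k; first by rewrite e leq_addl.
split; first by rewrite {1}e addnK.
have h j : k < j -> halve_parts w j = 0.
  rewrite /halve_parts => kj; have [jn|nj] := ltnP j n.+1; last first.
    by apply: wn; apply: leq_trans nj _; rewrite -addnn leq_addr.
  apply/eqP; rewrite -leqn0 leqNgt; apply/negP => wj.
  suff : j <= k by rewrite leqNgt kj.
  rewrite /k (bigD1_seq j) ?iota_uniq ?mem_index_iota //=.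
  by apply: leq_trans (leq_addr _ _); rewrite leq_pmull.
split => //.
- by move=> i /wp; rewrite is_pow2_double.
rewrite (@sum_widen k.+1 n.+1) //; first by rewrite ltnS e; lia.
by move=> i /h ->.
Qed.

Lemma double_partsP n k w : 0 < n -> k.*2 <= n -> binary_multiplicities k w ->
  binary_multiplicities n (double_parts n k w).
Proof.
move=> n0 kn [w0 wp wn ws].
have dp i : 0 < double_parts n k w i -> is_pow2 i.
  rewrite /double_parts; case: eqP => [-> _|_]; first by apply/is_pow2P; exists 0.
  case: ifP => // oi /wp; rewrite -is_pow2_double -[X in is_pow2 X -> _]add0n.
  by rewrite -[X in X + _]/(nat_of_bool false) -oi odd_double_half.
have dn i : n < i -> double_parts n k w i = 0.
  rewrite /double_parts => ni; case: eqP => [i1|_]; first by move: ni n0; rewrite i1; lia.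
  by case: ifP => // oi; apply: wn; move: oi ni kn; clear; lia.
split => //.
rewrite (pow2_support_sum dp dn).
have e j : double_parts n k w j.*2 = w j.
  rewrite /double_parts odd_double doubleK; case: eqP => // h.
  by move: (congr1 odd h); rewrite odd_double.
under eq_bigr do rewrite e.
rewrite -(@sum_widen k.+1 n.+1) ?ws; first by rewrite /double_parts /= subnK.
  by rewrite ltnS; apply: leq_trans kn; rewrite -addnn leq_addr.
by move=> i /wn ->.
Qed.

(* Remove the parts equal to 1 and halve the others. *)
Lemma b1_rec n : b1 n = \sum_(k < n./2.+1) b1 k.
Proof.
case: (posnP n) => [->|n0]; first by rewrite big_ord_recl big_ord0 addn0.
(* The fibres are indexed by half the weight of the parts other than 1. The index is at most [n./2],
   so [inord] never takes its default value. *)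
pose f (mu : {ffun 'I_n.+1 -> 'I_n.+1}) : 'I_n./2.+1 := inord ((n - ffun_ext mu 1)./2).
rewrite /b1 -sum1_card (partition_big f xpredT) //=; apply: eq_bigr => k _.
have kn : k.*2 <= n by have := ltn_ord k; lia.
pose Phi (nu : {ffun 'I_k.+1 -> 'I_k.+1}) := ffun_mk n (double_parts n k (ffun_ext nu)).
have PhiK nu : nu \in bparts k -> ffun_ext (Phi nu) =1 double_parts n k (ffun_ext nu).
  by move=> /bpartsP h; apply: ffun_mkK; apply: double_partsP.
rewrite sum1dep_card -[RHS](@card_in_imset _ _ Phi) => [|nu nu' hn hn' e].
  apply: eq_card => mu; rewrite inE; apply/andP/imsetP => [[/bpartsP hmu /eqP fk]|[nu hn ->]].
    have [k' k'n [w1 hk']] := halve_partsP hmu.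
    have ek : k = k' :> nat.
      by rewrite -fk /f w1 subKn // doubleK inordK // ltnS; lia.
    rewrite -ek in w1 hk' k'n.
    exists (ffun_mk k (halve_parts (ffun_ext mu))).
      by apply/bpartsP; have /funext -> := ffun_mkK hk'.
    apply: ffun_ext_inj => i; rewrite ffun_mkK; last first.
      by apply: double_partsP => //; have /funext -> := ffun_mkK hk'.
    rewrite /double_parts ffun_mkK //; case: eqP => [-> //|i1].
    case: (boolP (odd i)) => oi.
      case: (posnP (ffun_ext mu i)) => // wi; case: hmu => _ /(_ _ wi) h _ _.
      by have := is_pow2_odd h oi.
    by rewrite /halve_parts -[in LHS](odd_double_half i) (negbTE oi).
  split.
    by apply/bpartsP; have /funext -> := PhiK _ hn; apply: double_partsP => //; apply/bpartsP.
  by apply/eqP/val_inj; rewrite /= /f PhiK // /double_parts /= subKn // doubleK inordK.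
apply: ffun_ext_inj => i.
have := congr1 (fun mu => ffun_ext mu i.*2) e.
rewrite /= !PhiK // /double_parts odd_double doubleK; case: eqP => // h.
by move: (congr1 odd h); rewrite odd_double.
Qed.
End BinaryPartitionRecurrence.

(** * The 2-adic recursion *)

Section BinaryPartitionMod32.
Local Open Scope nat_scope.

Lemma b1_0 : b1 0 = 1.
Proof.
apply/eqP; rewrite eqn_leq; apply/andP; split.
  by apply: leq_trans (max_card _) _; rewrite card_ffun !card_ord.
rewrite card_gt0; apply/set0Pn; exists (ffun_mk 0 (fun=> 0)).
have h : binary_multiplicities 0 (fun=> 0) by split => //; rewrite big_nat1.
by apply/bpartsP; have /funext -> := ffun_mkK h.
Qed.

Definition bp_even (n : nat) : nat := b1 n.*2.
Local Notation a := bp_even.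

Lemma b1_half n : b1 n = a n./2.
Proof. by rewrite /a b1_rec [RHS]b1_rec doubleK. Qed.

Lemma bp_even0 : a 0 = 1.
Proof. exact: b1_0. Qed.

Lemma bp_evenS n : a n.+1 = a n + a n.+1./2.
Proof. by rewrite -b1_half /a [LHS]b1_rec [b1 n.*2]b1_rec !doubleK big_ord_recr. Qed.

Definition bp_sum (n : nat) : nat := \sum_(0 <= j < n.+1) a j.
Definition bp_sum2 (n : nat) : nat := \sum_(0 <= j < n.+1) bp_sum j.
Definition bp_sum3 (n : nat) : nat := \sum_(0 <= j < n.+1) bp_sum2 j.
Local Notation D := bp_sum.
Local Notation G := bp_sum2.
Local Notation H := bp_sum3.

Lemma bp_sumS n : D n.+1 = D n + a n.+1. Proof. by rewrite /D big_nat_recr. Qed.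
Lemma bp_sum2S n : G n.+1 = G n + D n.+1. Proof. by rewrite /G big_nat_recr. Qed.
Lemma bp_sum3S n : H n.+1 = H n + G n.+1. Proof. by rewrite /H big_nat_recr. Qed.
Lemma bp_sum_0 : [/\ D 0 = 1, G 0 = 1 & H 0 = 1].
Proof. by rewrite /H /G /D !big_nat1 bp_even0. Qed.

Lemma bp_evenD n : a n.*2.+1 = a n.*2 + a n /\ a n.+1.*2 = a n.*2.+1 + a n.+1.
Proof.
split; first by rewrite bp_evenS /= uphalf_double.
by rewrite doubleS bp_evenS /= doubleK.
Qed.

Lemma bp_even_double n : a n.*2.+1 = 2 * D n /\ a n.*2 + a n = 2 * D n.
Proof.
suff h : a n.*2.+1 = 2 * D n by split=> //; have [] := bp_evenD n; lia.
elim: n => [|n IH].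
  by have [D0 _ _] := bp_sum_0; have [-> _] := bp_evenD 0; rewrite D0 bp_even0.
have [e1 _] := bp_evenD n.+1; have [_ e2] := bp_evenD n.
by rewrite e1 e2 bp_sumS IH; lia.
Qed.

Lemma bp_sum_double n : D n.*2.+1 + D n = 4 * G n /\ D n.*2 + 3 * D n = 4 * G n.
Proof.
have [D0 G0 _] := bp_sum_0.
suff h : D n.*2.+1 + D n = 4 * G n.
  by split=> //; have [e _] := bp_even_double n; have := bp_sumS n.*2; lia.
elim: n => [|n IH].
  by have [e _] := bp_even_double 0; rewrite double0 in e *; rewrite bp_sumS e D0 G0.
have [e1 e2] := bp_even_double n.+1; rewrite doubleS in e1 e2 *.
by have := bp_sumS n; have := bp_sum2S n; have := bp_sumS n.*2.+1; have := bp_sumS n.*2.+2; lia.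
Qed.

(** Each further summation doubles the coefficient: 2, 4, now 8. So [H] disappears modulo 8, and
    [(D, G)] at [n.*2] and [n.*2.+1] depends modulo 8 only on [(D, G)] at [n]. *)
Lemma bp_sum2_double n : G n.*2.+1 + 4 * G n = 8 * H n /\ G n.*2 + D n.*2.+1 = G n.*2.+1.
Proof.
have [D0 G0 H0] := bp_sum_0.
split; last by rewrite bp_sum2S.
elim: n => [|n IH].
  by have := bp_sum_double 0; have := bp_sum2S 0; rewrite double0 D0 G0 H0; lia.
have [e1 e2] := bp_sum_double n.+1; rewrite doubleS in e1 e2 *.
have := bp_sum2S n; have := bp_sum3S n; have := bp_sum2S n.*2.+1; have := bp_sum2S n.*2.+2; lia.
Qed.

Lemma bp_even_quad n : a (4 * n.+1) = a n.+1 + 8 * G n /\ a (4 * n + 2) + 4 * D n = 8 * G n.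
Proof.
have [_ e1] := bp_even_double n.+1; have [_ e2] := bp_even_double n.+1.*2.
have [e3 e4] := bp_sum_double n.+1; have e5 := bp_sum2S n.
have [_ e6] := bp_even_double n.*2.+1; have [e7 _] := bp_even_double n.
have [e8 e9] := bp_sum_double n.
have -> : 4 * n.+1 = n.+1.*2.*2 by lia.
have -> : 4 * n + 2 = n.*2.+1.*2 by lia.
lia.
Qed.

(* By [odious_double] this is the Thue-Morse predicate: [p] has an odd number of
   binary digits 1. *)
Definition odious (p : nat) : bool := (D p + 4 * p) %% 8 == 7.

(** [D p + 4 * p] is 1 or -1 modulo 8. Since [G q] and [q] have opposite parity, [4 * G q] is
    [4 * (q + 1)] modulo 8; by [bp_sum_double], appending the binary digit 0 then preserves the sign
    and appending 1 reverses it. *)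
Lemma bp_sum_mod8 p :
  [/\ (D p + 4 * p) %% 8 = (if odious p then 7 else 1),
      odd p -> G p %% 4 = 0 & ~~ odd p -> odd (G p)].
Proof.
elim/ltn_ind: p => p IH; have [p0|p0] := posnP p.
  by have [D0 G0 _] := bp_sum_0; rewrite /odious p0 D0 G0.
have [|h1 h2 h3] := IH p./2; first by lia.
have e := odd_double_half p; set q := p./2 in h1 h2 h3 e.
have oD : odd (D q) by move: h1; case: odious; lia.
have [d1 d2] := bp_sum_double q; have [g1 g2] := bp_sum2_double q.
have hG : odd q != odd (G q).
  by case: (boolP (odd q)) => [/h2|/h3 ->] //; lia.
rewrite -e; case: (odd p) => /=; rewrite ?add1n ?add0n /=; split; rewrite /odious /=.
- by move: h1; case: (odious q) => h1; case: ifP; lia.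
- by lia.
- by rewrite odd_double.
- by move: h1; case: (odious q) => h1; case: ifP; lia.
- by rewrite odd_double.
- by lia.
Qed.

Lemma odious0 : odious 0 = false.
Proof. by have [D0 _ _] := bp_sum_0; rewrite /odious D0. Qed.

Lemma odious_double q : odious q.*2 = odious q /\ odious q.*2.+1 = ~~ odious q.
Proof.
have [h1 h2 h3] := bp_sum_mod8 q; have [d1 d2] := bp_sum_double q.
have hG : odd q != odd (G q).
  by case: (boolP (odd q)) => [/h2|/h3 ->] //; lia.
by move: h1; case: (odious q) => h1; split; rewrite /odious; lia.
Qed.

(* [b1 (4 * m) = b1 (4 * m + 1) = 28] modulo 32. *)
Definition bp_28 (m : nat) : bool := a m.*2 %% 32 == 28.

(** [G] is divisible by 4 at odd arguments, so its term drops out modulo 32 in the first and last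
    cases. In the third case the value is 2 modulo 4; in the last it is 12 or 20. *)
Lemma bp_28_rec m :
  [/\ bp_28 (4 * m) = bp_28 m, bp_28 (4 * m + 1) = odious m,
      bp_28 (4 * m + 2) = false & bp_28 (4 * m + 3) = false].
Proof.
have two j : ~~ odd j -> a (4 * j.+1) %% 32 == 28 = false.
  move=> oj; have [e _] := bp_even_quad j; have := bp_even_double j./2.
  have -> : j./2.*2.+1 = j.+1 by lia.
  case=> e1 _; have [h _ _] := bp_sum_mod8 j./2.
  by rewrite e e1; move: h; case: odious; lia.
split.
- case: m => [|m]; first by rewrite muln0.
  rewrite /bp_28; have -> : (4 * m.+1).*2 = 4 * m.*2.+1.+1 by lia.
  have [-> _] := bp_even_quad m.*2.+1; have [_ h _] := bp_sum_mod8 m.*2.+1.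
  have := h (ltac:(by rewrite /= odd_double)); rewrite -doubleS.
  by move: (G _) (a _); clear; lia.
- rewrite /bp_28; have -> : (4 * m + 1).*2 = 4 * m.*2 + 2 by lia.
  have [_ e] := bp_even_quad m.*2; have [h1 h2 h3] := bp_sum_mod8 m.
  have [d1 d2] := bp_sum_double m; have [g1 g2] := bp_sum2_double m.
  have hG : odd m != odd (G m) by case: (boolP (odd m)) => [/h2|/h3 ->] //; lia.
  by move: h1 hG e d1 d2 g1 g2; clear; case: (odious m); lia.
- rewrite /bp_28; have -> : (4 * m + 2).*2 = 4 * m.*2.+1 by lia.
  by apply: two; rewrite odd_double.
rewrite /bp_28; have -> : (4 * m + 3).*2 = 4 * m.*2.+1 + 2 by lia.
have [_ e] := bp_even_quad m.*2.+1; have [h1 h2 _] := bp_sum_mod8 m.*2.+1.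
have := h2 (ltac:(by rewrite /= odd_double)).
by move: h1; case: (odious _); lia.
Qed.

Lemma bp_even_class n : 0 < n -> (a n %% 4 == 2) || (a n %% 8 == 4).
Proof.
elim/ltn_ind: n => n IH n0.
have [h|h] : odd n \/ ~~ odd n by case: odd; [left|right].
  have [e _] := bp_even_double n./2; have [k _ _] := bp_sum_mod8 n./2.
  have en : n./2.*2.+1 = n by lia.
  by rewrite en in e; rewrite e; move: k; case: odious; lia.
have [j [en|en]] : exists j, n = 4 * j.+1 \/ n = 4 * j + 2.
  by exists (if n %% 4 == 0 then (n %/ 4).-1 else n %/ 4); case: eqP => h4; [left|right]; lia.
  have [e _] := bp_even_quad j; have := IH j.+1 (ltac:(lia)) isT.
  by rewrite en e; lia.
have [_ e] := bp_even_quad j; have [k _ _] := bp_sum_mod8 j.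
by rewrite en; move: k; case: odious; lia.
Qed.

Lemma b1_28 N : (b1 N %% 32 == 28) = (N %% 4 < 2) && bp_28 (N %/ 4).
Proof.
rewrite b1_half; case: leqP => h /=.
  have [e _] := bp_even_double (N %/ 4); have [k _ _] := bp_sum_mod8 (N %/ 4).
  have -> : N./2 = (N %/ 4).*2.+1 by lia.
  by rewrite e; move: k; case: odious; lia.
by rewrite /bp_28; have -> : N./2 = (N %/ 4).*2 by lia.
Qed.
End BinaryPartitionMod32.

Lemma not_sum3squares_28 n : (n %% 32 == 28)%N -> ~ sum3squares n.
Proof.
move=> n28 [x [y [z e]]]; pose sq32 : seq nat := [:: 0; 1; 4; 9; 16; 17; 25].
have sq (k : nat) : ((k ^ 2) %% 32)%N \in sq32.
  have h : all (fun i => (i ^ 2) %% 32 \in sq32)%N (iota 0 32) by [].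
  by rewrite -modnXm; apply: (allP h); rewrite mem_iota ltn_mod.
have {}e : n = (`|x| ^ 2 + `|y| ^ 2 + `|z| ^ 2)%N.
  apply/eqP; rewrite -eqz_nat e !PoszD; apply/eqP.
  have sqE (u : int) : u ^+ 2 = (`|u| ^ 2)%N%:Z.
    by rewrite -mulnn PoszM !abszE -expr2 real_normK ?num_real.
  by rewrite !sqE.
have h : all (fun i => all (fun j => all (fun k => (i + j + k) %% 32 != 28)%N sq32) sq32) sq32 by [].
have := allP (allP (allP h _ (sq `|x|%N)) _ (sq `|y|%N)) _ (sq `|z|%N).
by rewrite modnDmr -modnDml modnDm modnDml -e n28.
Qed.

(** When the value is 4 modulo 8, its quarter is odd, and is 7 modulo 8 exactly when the value is 28
    modulo 32. Otherwise the quarter is a sum of three squares and 4 is a square. *)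
Lemma S1P (R : realType) n : S1 n <-> (b1 n %% 32 == 28)%N.
Proof.
have e : S1 n <-> ~ sum3squares (b1 n).
  split=> [h [x [y [z]]]|h x y z exyz]; first exact: h.
  by apply: h; exists x, y, z.
rewrite e; split; last exact: not_sum3squares_28.
move=> h; apply: contrapT => nh; apply: h.
rewrite b1_half in nh *; have [n0|n0] := posnP n./2.
  by rewrite n0 bp_even0; exists 1, 0, 0.
have := bp_even_class n0; move: nh; set c := bp_even _ => nh /orP[c4|c4].
  by apply: (three_squares R); rewrite c4 orbT.
have [x [y [z exyz]]] : sum3squares (c %/ 4).
  by apply: (three_squares R); move: c4 nh; clear; lia.
exists (2 * x), (2 * y), (2 * z).
have -> : c = (4 * (c %/ 4))%N by move: c4; clear; lia.
by rewrite PoszM exyz; ring.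
Qed.

(** * The counting function *)

Section Counting.
Local Open Scope nat_scope.

(** The ranges of [count_28] and [count_S1] include their end, that of [count_odious] does not;
    hence the shift by [0 < r] in [count_28_quad]. *)
Definition count_28 (M : nat) : nat := \sum_(0 <= m < M.+1) bp_28 m.
Definition count_odious (P : nat) : nat := \sum_(0 <= p < P) odious p.
Definition count_S1 (N : nat) : nat := \sum_(0 <= n < N.+1) (b1 n %% 32 == 28).
Local Notation E := count_28.
Local Notation O := count_odious.

Lemma bp_28_0 : bp_28 0 = false.
Proof. by rewrite /bp_28 bp_even0. Qed.

Lemma count_28S M : E M.+1 = E M + bp_28 M.+1.
Proof. by rewrite /E big_nat_recr. Qed.

Lemma count_28_0 : E 0 = 0.
Proof. by rewrite /E big_nat1 bp_28_0. Qed.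

Lemma count_odious_double P : O P.*2 = P /\ O P.*2.+1 = P + odious P.
Proof.
have h : O P.*2 = P.
  elim: P => [|P IH]; first by rewrite /O big_geq.
  have [e1 e2] := odious_double P.
  by rewrite doubleS /O !big_nat_recr //= -/(O P.*2) IH e1 e2; case: odious; lia.
split=> //; have [e1 _] := odious_double P.
by rewrite /O big_nat_recr //= -/(O P.*2) h e1.
Qed.

Lemma count_28_quad Q r : r < 4 -> E (4 * Q + r) = O (Q + (0 < r)) + E Q.
Proof.
have h : E (4 * Q) = O Q + E Q.
  elim: Q => [|Q IH]; first by rewrite muln0 /O big_geq.
  have [_ e1 e2 e3] := bp_28_rec Q; have [e4 _ _ _] := bp_28_rec Q.+1.
  rewrite count_28S -e4 /O big_nat_recr //= -/(O Q).
  rewrite (_ : 4 * Q.+1 = (4 * Q).+4); last by lia.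
  rewrite addn1 in e1; rewrite addn2 in e2; rewrite addn3 in e3.
  by rewrite !count_28S IH e1 e2 e3; lia.
have [_ e1 e2 e3] := bp_28_rec Q.
have e0 : O Q.+1 = O Q + odious Q by rewrite /O big_nat_recr.
rewrite addn1 in e1; rewrite addn2 in e2; rewrite addn3 in e3.
case: r => [|[|[|[|//]]]] _ /=; rewrite ?addn0 ?addn1 ?addn2 ?addn3 ?count_28S ?h ?e1 ?e2 ?e3 ?e0; lia.
Qed.

Lemma odious_quad Q :
  [/\ odious (4 * Q) = odious Q, odious (4 * Q + 1) = ~~ odious Q,
      odious (4 * Q + 2) = ~~ odious Q & odious (4 * Q + 3) = odious Q].
Proof.
have [e1 e2] := odious_double Q; have [e3 e4] := odious_double Q.*2.
have [e5 e6] := odious_double Q.*2.+1.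
have -> : 4 * Q = Q.*2.*2 by lia.
by rewrite addn1 addn2 addn3 -doubleS e3 e4 e5 e6 e1 e2 negbK.
Qed.

Lemma odious_pred Q : odd Q -> odious Q.-1 = ~~ odious Q.
Proof.
move=> oQ; have [e1 e2] := odious_double Q./2.
have -> : Q.-1 = Q./2.*2 by lia.
have {2}-> : Q = Q./2.*2.+1 by lia.
by rewrite e1 e2 negbK.
Qed.

(** [2 * O Q - Q] is 0 for even [Q] and 1 or -1 for odd [Q], written without subtraction. Each pair
    [q.*2], [q.*2.+1] holds one odious number, so only an unpaired last one matters. *)
Lemma double_count_odious Q :
  2 * O Q + odd Q * odious Q = Q + odd Q * ~~ odious Q.
Proof.
have [d1 d2] := count_odious_double Q./2; have [e1 e2] := odious_double Q./2.
have := odd_double_half Q; case: (odd Q) => /=; rewrite ?add1n ?add0n => eQ.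
  by rewrite -eQ d2 e2 negbK; case: odious; lia.
by rewrite -[in O Q]eQ d1; lia.
Qed.

Lemma count_28_step M : 0 < M -> exists Q r,
  [/\ Q < M, M = 4 * Q + r, r < 4, E M = O Q + (0 < r) * odious Q + E Q
    & odious M = odd r (+) (1 < r) (+) odious Q].
Proof.
move=> M0; exists (M %/ 4), (M %% 4); set Q := M %/ 4.
have e : M = 4 * Q + M %% 4 by rewrite mulnC -divn_eq.
have r4 : M %% 4 < 4 by rewrite ltn_mod.
split => //; first by rewrite ltn_Pdiv.
  rewrite [in LHS]e count_28_quad //; case: (0 < _); rewrite ?addn0 ?addn1 //.
  by rewrite /O big_nat_recr //= mul1n.
have [q0 q1 q2 q3] := odious_quad Q; rewrite [in LHS]e.
move: (M %% 4) r4 => [|[|[|[|//]]]] _ /=; rewrite ?addn0 ?q0 ?q1 ?q2 ?q3;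
  by case: (odious Q).
Qed.

(* The refined bound for even [M] pays for the largest loss in one step
   [M = 4 * Q + r] of the recursion. *)
Lemma count_28_lower M :
  M <= 6 * E M + 4 /\ (~~ odd M -> ~~ odious M -> M <= 6 * E M + 1).
Proof.
elim/ltn_ind: M => M IH; have [M0|M0] := posnP M; first by rewrite M0.
have [Q [r [QM e r4 eE oM]]] := count_28_step M0.
have dQ := double_count_odious Q.
have [h1 h2] := IH _ QM.
(* The predecessor of an odd odious number is even and not odious, so the refined bound applies to
   it. *)
have h3 : odd Q -> odious Q -> Q <= 6 * E Q + 2.
  move=> oQ qQ; have [_ h] := IH Q.-1 (leq_ltn_trans (leq_pred Q) QM).
  have {}h := h _ _; rewrite odious_pred // qQ in h.
  have eQ : Q = Q.-1.+1 by lia.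
  by rewrite [in E Q]eQ count_28S; have := h (ltac:(lia)) isT; lia.
rewrite oM eE; move: e h1 h2 h3 dQ r4; clear; case: (odious Q); case: (boolP (odd Q)) => /= oQ;
  case: r => [|[|[|[|//]]]] /=; lia.
Qed.

(** Passing from [Q] to [4 * Q + r] raises [j] by 2 and so allows [12 * E M - 2 * M] to grow by 6.
    Only an even odious [Q] with [r] equal to 1 or 2 exceeds this, by at most 4; the second bound
    holds these 4 in reserve. *)
Lemma count_28_upper j M : 2 ^ j.+1 <= M < 2 ^ j.+2 ->
  12 * E M <= 2 * M + 3 * j /\
  (~~ odd M -> odious M -> 12 * E M + 4 <= 2 * M + 3 * j).
Proof.
elim/ltn_ind: j M => j IH M /andP[M1 M2].
have M0 : 0 < M by apply: leq_trans M1; rewrite expn_gt0.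
have [Q [r [QM e r4 eE oM]]] := count_28_step M0.
have dQ := double_count_odious Q.
have x0 := odious0; have [x1 x2] := odious_double 0; 
have [y1 y2] := count_odious_double 0; 
rewrite !double0 in x1 x2 y1 y2.
(* For [j = 0, 1] the quotient is 0 or 1, below the range of the induction hypothesis. *)
case: j IH M1 M2 => [|[|j]] IH M1 M2.
- have Q0 : Q = 0 by lia.
  rewrite Q0 y1 count_28_0 x0 in eE dQ oM.
  by rewrite eE; case: (0 < r); lia.
- have Q1 : Q = 1 by lia.
  have E1 : E 1 = 0 by have := @count_28_quad 0 1 isT; rewrite muln0 !add0n => ->; rewrite y2 x0 count_28_0.
  rewrite Q1 E1 y2 x2 x0 in eE dQ oM; rewrite eE oM.
  by move: e M1 M2 r4; case: r {eE oM} => [|[|[|[|//]]]] /=; lia.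
have [] := IH j (ltac:(lia)) Q.
  by move: M1 M2; rewrite !expnS; lia.
move=> h1 h2; rewrite oM eE; move: e h1 h2 dQ r4; clear.
case: (odious Q); case: (boolP (odd Q)) => /= oQ;
  case: r => [|[|[|[|//]]]] /=; lia.
Qed.

(** Each [m] counted by [E] gives [4 * m] and [4 * m + 1]. If [r = 0], the second element of the
    last pair is out of range, which the added term corrects. *)
Lemma count_S1_quad M r : r < 4 ->
  count_S1 (4 * M + r) + (r == 0) * bp_28 M = 2 * E M.
Proof.
have s0 m : (b1 (4 * m) %% 32 == 28) = bp_28 m.
  by rewrite b1_28 mulnC modnMl mulnK.
have s1 m : (b1 (4 * m + 1) %% 32 == 28) = bp_28 m.
  by rewrite b1_28 mulnC modnMDl divnMDl // addn0.
have s2 m : (b1 (4 * m + 2) %% 32 == 28) = false by rewrite b1_28 mulnC modnMDl.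
have s3 m : (b1 (4 * m + 3) %% 32 == 28) = false by rewrite b1_28 mulnC modnMDl.
have cS N : count_S1 N.+1 = count_S1 N + (b1 N.+1 %% 32 == 28) by rewrite /count_S1 big_nat_recr.
have h : count_S1 (4 * M) + bp_28 M = 2 * E M.
  elim: M => [|M IH].
    by rewrite muln0 count_28_0 bp_28_0 /count_S1 big_nat1 b1_28 bp_28_0.
  have := s1 M; have := s2 M; have := s3 M; have := s0 M.+1.
  have -> : 4 * M.+1 = (4 * M).+4 by lia.
  rewrite addn1 addn2 addn3 !cS => -> -> -> ->.
  by rewrite count_28S; move: IH; clear; lia.
have := s1 M; have := s2 M; have := s3 M; rewrite addn1 addn2 addn3.
case: r => [|[|[|[|//]]]] e3 e2 e1 _; rewrite ?addn0 ?addn1 ?addn2 ?addn3 ?cS ?e1 ?e2 ?e3; move: h; clear; lia.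
Qed.

(** The worst case is [r = 3], where 20 arises as 4 times the 4 of [count_28_lower], plus 4.
    Together with [x < N + 1] it becomes the strict bound -20/12. *)
Lemma count_S1_lower N : N.+1 <= 12 * count_S1 N + 20.
Proof.
have e := divn_eq N 4; set M := N %/ 4 in e; set r := N %% 4 in e.
have r4 : r < 4 by rewrite ltn_mod.
have := count_S1_quad M r4; rewrite mulnC -e.
have [h _] := count_28_lower M.
have h2 : bp_28 M -> M <= 6 * E M + 1.
  move=> eM; case: M h eM {e} => // M _ eM; rewrite count_28S eM.
  by have [h _] := count_28_lower M; lia.
by move: e h h2; move: (bp_28 M) (count_S1 N) (E M) => [] c x; clear; case: (r == 0); lia.
Qed.

(** Take [i = j + 3] for [M = N %/ 4]: doubling [count_28_upper] gives
    [12 * count_S1 N + 18 + r <= N + 6 * i] for [r > 0], so 19 is attained only at [r = 1], where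
    [2 ^ i < N]. The disjunction keeps the final inequality strict. *)
Lemma count_S1_upper N : 8 <= N -> exists i,
  2 ^ i <= N /\ (12 * count_S1 N + 19 <= N + 6 * i /\ (2 ^ i < N \/ 12 * count_S1 N + 19 < N + 6 * i)).
Proof.
move=> N8; have e := divn_eq N 4; set M := N %/ 4 in e; set r := N %% 4 in e.
have r4 : r < 4 by rewrite ltn_mod.
have M2 : 2 <= M by lia.
have := count_S1_quad M r4; rewrite mulnC -e => hc.
have [j /andP[j1 j2]] : exists j, 2 ^ j.+1 <= M < 2 ^ j.+2.
  have := trunc_log_bounds (isT : 1 < 2) (ltnW M2).
  case: (trunc_log 2 M) => [|j] h; last by exists j.
  by exfalso; move: h M2; clear; case: M => [|[|]].
have [h _] := count_28_upper (introT andP (conj j1 j2)).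
exists j.+3; have e4 : 2 ^ j.+3 = 4 * 2 ^ j.+1 by rewrite !expnS mulnA.
split; first by move: j1 e4 e; clear; lia.
case: (posnP r) => r0 in hc e; last first.
  by rewrite mul0n addn0 in hc; move: hc e h j1 e4 r0; clear; lia.
rewrite mul1n in hc; case: (boolP (bp_28 M)) => eM; rewrite ?eM ?(negbTE eM) in hc.
  by move: hc e h r0; clear; lia.
(* For [r = 0] the bound at [M] yields 18 instead of 19. As [M] is not counted, the bound at [M.-1]
   serves and saves enough. *)
suff h' : 12 * E M <= 2 * M.-1 + 3 * j \/ M = 2 by move: hc e h h' r0 M2; clear; lia.
have eM1 : E M = E M.-1 by rewrite -[in LHS](prednK (ltnW M2)) count_28S prednK ?(ltnW M2) // (negbTE eM) addn0.
have [k1|k1] := leqP (2 ^ j.+1) M.-1.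
  left; rewrite eM1; have [|//] := @count_28_upper j M.-1.
  by rewrite k1 /=; move: j2 M2; clear; lia.
case: j j1 j2 h e4 k1 => [|j] j1 j2 h e4 k1; first by right; move: j1 k1; rewrite expn1; clear; lia.
left; rewrite eM1; have [|h' _] := @count_28_upper j M.-1.
  by rewrite k1 andbT; move: j1; rewrite !expnS; move: (2 ^ j) (expn_gt0 2 j) => x x0; clear -x0; lia.
by apply: leq_trans h' _; rewrite leq_add2l leq_mul2l leqnSn.
Qed.

(* The binary expansion is [1001] repeated: every block of four digits realizes the
   maximal gain allowed by [count_28_upper]. *)
Fixpoint extremal (l : nat) : nat := if l is l'.+1 then 16 * extremal l' + 9 else 9.

(** For [M] odd and not odious, [4 * M + 2] is even and odious; the steps to it and to [16 * M + 9]
    raise [12 * E - 2 * M] by 2 and by 10, that is 3 per binary digit. The size bounds serve to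
    estimate the logarithm. *)
Lemma extremalP l : [/\ odd (extremal l), ~~ odious (extremal l),
   6 * E (extremal l) = extremal l + 3 + 6 * l & 8 * 16 ^ l <= extremal l < 10 * 16 ^ l].
Proof.
elim: l => [|l [om qm eE /andP[lb ub]]].
  have x0 := odious0; have [_ q1 q2 _] := odious_quad 0; rewrite muln0 !add0n x0 in q1 q2.
  have [_ q9 _ _] := odious_quad 2; rewrite q2 in q9.
  have e9 := @count_28_quad 2 1 isT; have e2 := @count_28_quad 0 2 isT.
  have d2 : O 3 = 2 by rewrite /O !big_nat_recr //= big_geq // x0 q1 q2.
  have d0 : O 1 = 0 by rewrite /O big_nat1 x0.
  split => //; first by rewrite q9.
  by rewrite -[extremal 0]/(4 * 2 + 1) e9 -[E 2]/(E (4 * 0 + 2)) e2 d2 d0 count_28_0.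
set M := extremal l in om qm eE lb ub; rewrite -[extremal l.+1]/(16 * M + 9).
have eM : 16 * M + 9 = 4 * (4 * M + 2) + 1 by lia.
have [q0 q1 q2 q3] := odious_quad (4 * M + 2); have [_ _ q4 _] := odious_quad M.
have dM := double_count_odious M; rewrite om (negbTE qm) in dM.
have dM2 := double_count_odious (4 * M + 2).
have e1 := @count_28_quad (4 * M + 2) 1 isT; have e2 := @count_28_quad M 2 isT.
have OS Q : O Q.+1 = O Q + odious Q by rewrite /O big_nat_recr.
rewrite !addn1 !OS q4 qm in e1 e2 *.
have ev : odd (4 * M + 2) = false by lia.
rewrite ev in dM2; rewrite (negbTE qm) in e2.
split.
- by clear -om; lia.
- by rewrite eM addn1 -addn1 q1 q4 qm.
- rewrite eM addn1 e1 e2; move: dM dM2 eE; clear; lia.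
by rewrite expnS; apply/andP; move: lb ub; clear; lia.
Qed.

Lemma count_S1_extremal l : 12 * count_S1 (4 * extremal l + 1) = 4 * extremal l + 1 + 24 * l + 11.
Proof.
have [_ _ e _] := extremalP l; have := @count_S1_quad (extremal l) 1 isT.
by rewrite /= mul0n addn0 => ->; move: e; clear; lia.
Qed.
End Counting.

(** * Bounds for real arguments, density and asymptotics *)

Section RealBounds.
Variable R : realType.

Lemma counting_fun_S1 (x : R) : 0 <= x -> counting_fun S1 x = count_S1 (Num.truncn x).
Proof.
move=> x0; set N := Num.truncn x.
pose s := [seq n <- iota 0 N.+1 | (b1 n %% 32 == 28)%N].
have e : S1 `&` [set n | n%:R <= x] = [set` [fset n in s]%fset].
  apply/seteqP; split=> n /=; rewrite inE /= mem_filter mem_iota /= add0n ltnS.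
    by case=> /(S1P R) -> nx /=; rewrite -truncn_ge_nat // in nx.
  by move=> /andP[/(S1P R) hs]; rewrite truncn_ge_nat.
rewrite /counting_fun e set_fsetK card_fseq undup_id ?filter_uniq ?iota_uniq //.
rewrite size_filter /count_S1 -sum1_count big_mkcond /index_iota subn0.
by apply: eq_bigr => n _; case: (_ == _).
Qed.

Lemma ln2_gt0 : 0 < ln 2 :> R.
Proof. by rewrite ln_gt0 // ltr1n. Qed.

Lemma ln2_ge_half : 2^-1 <= ln 2 :> R.
Proof.
have := @ln_le_subr1 R 2^-1; rewrite invr_gt0 ltr0n lnV ?posrE // => /(_ isT); lra.
Qed.

Lemma log2_pow2 i : log2 (2 ^+ i : R) = i%:R.
Proof. by rewrite /log2 lnXn // -[ln 2 *+ i]mulr_natl mulfK // gt_eqF // ln2_gt0. Qed.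

Lemma ler_log2 (x y : R) : 0 < x -> x <= y -> log2 x <= log2 y.
Proof.
move=> x0 xy; rewrite /log2 ler_pM2r ?invr_gt0 ?ln2_gt0 // ler_ln ?posrE //.
exact: lt_le_trans xy.
Qed.

Lemma ltr_log2 (x y : R) : 0 < x -> x < y -> log2 x < log2 y.
Proof.
move=> x0 xy; rewrite /log2 ltr_pM2r ?invr_gt0 ?ln2_gt0 // ltr_ln ?posrE //.
exact: lt_trans xy.
Qed.

Lemma count_S1_bounds (x : R) : 6 <= x ->
  - (5 / 3) < (counting_fun S1 x)%:R - x / 12
  /\ (counting_fun S1 x)%:R - x / 12 < 1 / 2 * log2 x - 19 / 12.
Proof.
move=> x6; have x0 : 0 <= x by apply: le_trans x6.
rewrite counting_fun_S1 //; have := trunc_itv x0; set N := Num.truncn x => /andP[Nx xN].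
have N6 : (6 <= N)%N by rewrite truncn_ge_nat.
split.
  have := count_S1_lower N; rewrite -(ler_nat R) natrD natrM => h.
  by move: h xN; lra.
have [N8|N8] := leqP 8 N.
  have [i [iN [h1 h2]]] := count_S1_upper N8.
  have iNR : 2 ^+ i <= N%:R :> R by rewrite -natrX ler_nat.
  have li : i%:R <= log2 x by rewrite -log2_pow2 ler_log2 ?exprn_gt0 //; apply: le_trans Nx.
  have e1 : (12 * count_S1 N + 19)%:R = 12 * (count_S1 N)%:R + 19 :> R by rewrite natrD natrM.
  have e2 : (N + 6 * i)%:R = N%:R + 6 * i%:R :> R by rewrite natrD natrM.
  move: h1; rewrite -(ler_nat R) e1 e2 => h1.
  case: h2 => [iN'|]; last first.
    by rewrite -(ltr_nat R) e1 e2 => h2; move: h2 li Nx; lra.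
  have li' : i%:R < log2 x.
    rewrite -log2_pow2 ltr_log2 ?exprn_gt0 //; apply: lt_le_trans Nx.
    by rewrite -natrX ltr_nat.
  by move: h1 li' Nx; lra.
(* For [6 <= x < 8] nothing is counted yet; the claim is [19 < x + 6 * log2 x], and
   [2 * log2 x >= 5] follows from [6 ^ 2 >= 2 ^ 5]. *)
have -> : count_S1 N = 0%N.
  have E1 : count_28 1 = 0%N.
    have := @count_28_quad 0 1 isT; rewrite muln0 add0n => ->.
    by rewrite count_28_0 /count_odious big_nat1 odious0.
  have := @count_S1_quad 1 (N - 4) (ltac:(lia)); rewrite E1 muln0.
  by have -> : (4 * 1 + (N - 4))%N = N by [lia]; move=> /eqP; rewrite addn_eq0 => /andP[/eqP].
have h5 : 5 <= 2 * log2 x.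
  have -> : 2 * log2 x = log2 (x ^+ 2).
    by rewrite /log2 lnXn ?mulr2n; [ring | apply: lt_le_trans x6].
  rewrite -(log2_pow2 5); apply: ler_log2; rewrite ?exprn_gt0 //.
  apply: (@le_trans _ _ (6 ^+ 2)); first by rewrite -!natrX ler_nat.
  by rewrite lerXn2r // nnegrE.
by move: h5 x6; lra.
Qed.

Lemma log2_le_sqrt (x : R) : 0 < x -> log2 x <= 4 * Num.sqrt x.
Proof.
move=> x0; have r0 : 0 < Num.sqrt x by rewrite sqrtr_gt0.
rewrite /log2 ler_pdivrMr ?ln2_gt0 //.
have -> : ln x = 2 * ln (Num.sqrt x).
  by rewrite -{1}(sqr_sqrtr (ltW x0)) lnXn // mulr_natl.
have h := ln_le_subr1 r0; have h2 := ln2_ge_half.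
apply: (@le_trans _ _ (2 * Num.sqrt x)); first by lra.
by rewrite -(ler_pM2l r0) in h2; lra.
Qed.

Lemma count_S1_ratio (x : R) : 6 <= x ->
  `|1 / 12 - (counting_fun S1 x)%:R / x| <= 2 / Num.sqrt x.
Proof.
move=> x6; have x0 : 0 < x by apply: lt_le_trans x6.
have [h1 h2] := count_S1_bounds x6; have h3 := log2_le_sqrt x0.
have r0 : 0 < Num.sqrt x by rewrite sqrtr_gt0.
have r1 : 1 <= Num.sqrt x.
  by rewrite -sqrtr1 ler_wsqrtr //; apply: le_trans x6; rewrite ler1n.
have -> : 1 / 12 - (counting_fun S1 x)%:R / x = - ((counting_fun S1 x)%:R - x / 12) / x.
  by field; rewrite gt_eqF.
have -> : 2 / Num.sqrt x = 2 * Num.sqrt x / x.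
  by rewrite -{3}(sqr_sqrtr (ltW x0)); field; rewrite gt_eqF.
rewrite normrM normrN normfV (gtr0_norm x0) ler_pM2r ?invr_gt0 // ler_norml.
by apply/andP; split; lra.
Qed.

Lemma count_S1_cvg : (counting_fun S1 x)%:R / x @[x --> +oo%R] --> (1 / 12 : R).
Proof.
apply/cvgrPdist_le => e e0; near=> x.
have x6 : 6 <= x by near: x; apply: nbhs_pinfty_ge; rewrite num_real.
apply: le_trans (count_S1_ratio x6) _.
have x0 : 0 < x by apply: lt_le_trans x6.
rewrite ler_pdivrMr ?sqrtr_gt0 // -ler_pdivrMl // -ler_sqr ?nnegrE ?mulr_ge0 ?invr_ge0 ?(ltW e0) //.
rewrite sqr_sqrtr ?(ltW x0) //.
Unshelve. all: by end_near. Qed.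

(** The excess is exactly [2 l + 11 / 12], while half the logarithm lies between [2 l + 5 / 2] and
    [2 l + 3]; their bounded difference makes the ratio tend to 1. *)
Lemma count_S1_asymp :
  asymp_equiv (fun l => (counting_fun S1 ((4 * extremal l + 1)%N%:R : R))%:R - (4 * extremal l + 1)%N%:R / 12)
    (fun l => 1 / 2 * log2 ((4 * extremal l + 1)%N%:R : R)).
Proof.
have bound (l : nat) : `|1 - ((counting_fun S1 ((4 * extremal l + 1)%N%:R : R))%:R - (4 * extremal l + 1)%N%:R / 12)
     / (1 / 2 * log2 ((4 * extremal l + 1)%N%:R : R))| <= 2 / l.+1%:R.
  set N := (4 * extremal l + 1)%N.
  rewrite counting_fun_S1 // natrK.
  have e : 12 * (count_S1 N)%:R = N%:R + 24 * l%:R + 11 :> R.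
    have := count_S1_extremal l; rewrite -/N => /(congr1 (GRing.natmul (1 : R))).
    by rewrite natrM natrD natrD natrM.
  have [_ _ _ /andP[b1 b2]] := extremalP l.
  have lo : (4 * l + 5)%:R <= log2 (N%:R : R).
    rewrite -(log2_pow2 (4 * l + 5)) ler_log2 ?exprn_gt0 // -natrX ler_nat.
    rewrite (_ : 2 ^ (4 * l + 5) = 32 * 16 ^ l)%N; last by rewrite expnD expnM mulnC.
    by rewrite /N; move: b1; move: (16 ^ l)%N; clear; lia.
  have up : log2 (N%:R : R) <= (4 * l + 6)%:R.
    rewrite -(log2_pow2 (4 * l + 6)) ler_log2 ?ltr0n /N ?addn1 // -natrX ler_nat.
    rewrite (_ : 2 ^ (4 * l + 6) = 64 * 16 ^ l)%N; last by rewrite expnD expnM mulnC.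
    by move: b2; move: (16 ^ l)%N; clear; lia.
  have -> : (count_S1 N)%:R - N%:R / 12 = 2 * l%:R + 11 / 12 :> R by move: e; lra.
  move: lo up; rewrite natrD natrM natrD natrM; move: (log2 _) => L lo up.
  have l0 : 0 <= l%:R :> R by [].
  have L0 : 0 < L by lra.
  have -> : 1 - (2 * l%:R + 11 / 12) / (1 / 2 * L) = (L / 2 - (2 * l%:R + 11 / 12)) / (L / 2).
    by field; rewrite gt_eqF.
  have n0 : 0 <= L / 2 - (2 * l%:R + 11 / 12) by lra.
  rewrite ger0_norm; last by rewrite divr_ge0 //; lra.
  rewrite ler_pdivrMr; last by lra.
  have d : L / 2 - (2 * l%:R + 11 / 12) <= 25 / 12 by lra.
  have l1 : 0 < l%:R + 1 :> R by lra.
  rewrite -[l.+1%:R]natr1 (_ : 2 / (l%:R + 1) * (L / 2) = L / (l%:R + 1)); last by field; rewrite gt_eqF.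
  rewrite ler_pdivlMr //; apply: le_trans (ler_wpM2r (ltW l1) d) _; lra.
apply/cvgrPdist_le => e e0; near=> l.
apply: le_trans (bound l) _.
rewrite ler_pdivrMr // -ler_pdivrMl //.
have : e^-1 * 2 < l%:R by near: l; apply: nbhs_infty_gtr.
by move/ltW => h; apply: le_trans h _; rewrite ler_nat.
Unshelve. all: by end_near. Qed.
End RealBounds.

Theorem theorem6p1 (R : realType) :
  [/\ forall x : R, 6 <= x ->
        - (5 / 3) < (counting_fun S1 x)%:R - x / 12
        /\ (counting_fun S1 x)%:R - x / 12 < 1 / 2 * log2 x - 19 / 12,
      has_natural_density S1 (1 / 12 : R),
      (counting_fun S1 x)%:R / x @[x --> +oo%R] --> (1 / 12 : R)
    & exists m : nat -> nat,
        {homo m : i j / (i < j)%N} /\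
        asymp_equiv
          (fun l => (counting_fun S1 ((m l)%:R : R))%:R - (m l)%:R / 12)
          (fun l => 1 / 2 * log2 ((m l)%:R : R)) ].
Proof.
split.
- exact: count_S1_bounds.
- by move/cvg_pinftyP: (@count_S1_cvg R) => /(_ _ cvgr_idn).
- exact: count_S1_cvg.
exists (fun l => 4 * extremal l + 1)%N; split; last exact: count_S1_asymp.
by apply: homo_ltn => [|l]; [exact: ltn_trans | rewrite /=; lia].
Qed.
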